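(* Let $k$ be a field, let $\prec$ be any term order on $k[x_0,\dots,x_n]$, let $1\le q\le n$ and let $a_q,\dots,a_1$ be any sequence of $q$ non-negative integers with $\sum a_i\neq 0$. Then the homogeneous stratum $\mathcal{S}t_h(J(a_q,\dots,a_1),\prec)$ is isomorphic to an affine space over $k$. The same holds for the stratum $\mathcal{S}t(J(a_q,\dots,a_1),\prec)$ if it is defined, i.e. if $\prec$ is reliable.
   Context: The ideals $J(a_q,\dots,a_1)$. Let $s\ge 0$ be the minimal index such that $a_{s+1}\ne 0$. Then $J(a_q,\dots,a_1)\subset k[x_0,\dots,x_n]$ is the monomial ideal generated by the $q-s$ monomials $$x_{n-i}\prod_{j=i}^{q}x_{n-j}^{a_j}\quad (s+2\le i\le q),\qquad\text{and}\qquad \prod_{j=s+1}^{q}x_{n-j}^{a_j}.$$ Equivalently, $J(a_q,\dots,a_1)=x_{n-q}^{a_q}\cdot\big((x_{n-q})+J(a_{q-1},\dots,a_1)\big)$ if $(a_{q-1},\dots,a_1)\neq(0,\dots,0)$, and $J(a_q,0,\dots,0)=(x_{n-q}^{a_q})$. Strata. Write $X$ for the variables of the polynomial ring. A term order is \emph{reliable} if for every monomial $X^\alpha$ the set of monomials $X^\beta\prec X^\alpha$ is finite. Put $\mathrm{tail}(X^\alpha)=\{X^\beta : X^\beta\prec X^\alpha\}$ and $\mathrm{htail}(X^\alpha)=\{X^\beta: X^\beta\prec X^\alpha,\ |\beta|=|\alpha|\}$. Let $J$ be a monomial ideal with minimal monomial generators $X^{\alpha_1},\dots,X^{\alpha_m}$.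 For each $i$ let $T_i$ be $\mathrm{tail}(X^{\alpha_i})\setminus J$ in the case of the stratum $\mathcal{S}t(J,\prec)$ (with $\prec$ reliable), and $\mathrm{htail}(X^{\alpha_i})\setminus J$ in the case of the homogeneous stratum $\mathcal{S}t_h(J,\prec)$ ($\prec$ arbitrary). Introduce a set $C$ of new variables $c_{i\beta}$, one for each $i$ and each $X^\beta\in T_i$, and set $F_i=X^{\alpha_i}+\sum_{X^\beta\in T_i}c_{i\beta}X^\beta$, with leading monomial $X^{\alpha_i}$ (as a polynomial in $X$ with coefficients in $k[C]$). For $i<j$ let $H_{ij}$ be a complete reduction of the $S$-polynomial of $F_i,F_j$ with respect to $\{F_1,\dots,F_m\}$ (division in the variables $X$ with coefficients in $k[C]$, so that no monomial in $X$ appearing in $H_{ij}$ lies in $J$). The stratum is the closed subscheme of the affine space $\mathbb{A}^{|C|}$ over $k$ defined by the ideal of $k[C]$ generated by all coefficients in $k[C]$ of the monomials in $X$ of all the $H_{ij}$ (this ideal is independent of the choice of reductions). *)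

(* Defs.v *)
From HB Require Import structures.
From Stdlib Require Import Relation_Operators.
From mathcomp Require Import all_boot all_order all_algebra.
From mathcomp Require Import finmap boolp classical_sets functions cardinality.
From mathcomp Require Import mpoly.

Set Implicit Arguments.
Unset Strict Implicit.
Unset Printing Implicit Defensive.

Import GRing.Theory.

Local Open Scope ring_scope.
Local Open Scope classical_set_scope.

Section IdealQuotient.
Variables (k : comNzRingType) (R : comAlgType k) (A : set R).

Definition ideal_gen : {pred R} := fun x =>
  `[< exists2 s : seq (R * R),
        (forall p, p \in s -> A p.2) & x = \sum_(p <- s) p.1 * p.2 >].

Lemma ideal_genP x : reflect
  (exists2 s : seq (R * R),
     (forall p, p \in s -> A p.2) & x = \sum_(p <- s) p.1 * p.2)
  (x \in ideal_gen).
Proof. by rewrite unfold_in /ideal_gen; apply: asboolP. Qed.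

Lemma ideal_genMl x y : y \in ideal_gen -> x * y \in ideal_gen.
Proof.
move=> /ideal_genP[s sA ->]; apply/ideal_genP.
exists [seq (x * p.1, p.2) | p <- s].
  by move=> _ /mapP[p ps ->] /=; exact: sA ps.
by rewrite big_map mulr_sumr; apply: eq_bigr => p _; rewrite mulrA.
Qed.

Lemma ideal_gen_zmod : zmod_closed ideal_gen.
Proof.
split=> [|x y xI yI]; first by apply/ideal_genP; exists [::]; rewrite ?big_nil.
have := ideal_genMl (- 1) yI; rewrite mulN1r => /ideal_genP[t tA ->].
move/ideal_genP: xI => [s sA ->]; apply/ideal_genP; exists (s ++ t).
  by move=> p; rewrite mem_cat => /orP[/sA|/tA].
by rewrite big_cat.
Qed.

HB.instance Definition _ :=
  GRing.isZmodClosed.Build R ideal_gen ideal_gen_zmod.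

(* Unlike the library's {ideal_quot _}, this quotient is also defined when the
   ideal is the whole ring; this is why it is only declared as a
   (possibly zero) commutative ring with a module structure over k. *)
Definition quot_alg := Quotient.quot ideal_gen.

HB.instance Definition _ := GRing.Zmodule.on quot_alg.

Definition quot_pi (x : R) : quot_alg := (\pi_quot_alg x)%qT.

Lemma quot_pi_eq x y : quot_pi x = quot_pi y <-> x - y \in ideal_gen.
Proof.
by rewrite Quotient.idealrBE; split=> [/eqP|/eqP].
Qed.

Lemma quot_pi_repr (x : quot_alg) : quot_pi (repr x) = x.
Proof. exact: reprK. Qed.

Lemma quot_piD x y : quot_pi (x + y) = quot_pi x + quot_pi y.
Proof. exact: Quotient.pi_add. Qed.

Definition quot_one : quot_alg := quot_pi 1.
Definition quot_mul (x y : quot_alg) : quot_alg := quot_pi (repr x * repr y).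
Definition quot_scale (c : k) (x : quot_alg) : quot_alg :=
  quot_pi (c *: repr x).

Lemma repr_quot_pi x : x - repr (quot_pi x) \in ideal_gen.
Proof. by apply/quot_pi_eq; rewrite quot_pi_repr. Qed.

Lemma quot_piM x y : quot_pi (x * y) = quot_mul (quot_pi x) (quot_pi y).
Proof.
apply/quot_pi_eq; set x' := repr _; set y' := repr _.
rewrite -[x * y](addrNK (x * y')) -mulrBr -addrA -mulrBl rpredD //.
  by rewrite ideal_genMl ?repr_quot_pi.
by rewrite mulrC ideal_genMl ?repr_quot_pi.
Qed.

Lemma quot_piZ c x : quot_pi (c *: x) = quot_scale c (quot_pi x).
Proof.
apply/quot_pi_eq; rewrite -scalerBr -mulr_algl.
by rewrite ideal_genMl ?repr_quot_pi.
Qed.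

Lemma quot_mulA : associative quot_mul.
Proof.
move=> x y z; rewrite -(quot_pi_repr x) -(quot_pi_repr y) -(quot_pi_repr z).
by rewrite -!quot_piM mulrA.
Qed.

Lemma quot_mulC : commutative quot_mul.
Proof. by move=> x y; rewrite /quot_mul mulrC. Qed.

Lemma quot_mul1 : left_id quot_one quot_mul.
Proof.
by move=> x; rewrite -(quot_pi_repr x) -quot_piM mul1r.
Qed.

Lemma quot_mulDl : left_distributive quot_mul +%R.
Proof.
move=> x y z; rewrite -(quot_pi_repr x) -(quot_pi_repr y) -(quot_pi_repr z).
by rewrite -quot_piD -!quot_piM mulrDl quot_piD.
Qed.

HB.instance Definition _ := GRing.Zmodule_isComPzRing.Build quot_alg
  quot_mulA quot_mulC quot_mul1 quot_mulDl.

Lemma quot_scaleA a b v : quot_scale a (quot_scale b v) = quot_scale (a * b) v.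
Proof. by rewrite -(quot_pi_repr v) -!quot_piZ scalerA. Qed.

Lemma quot_scale1 : left_id 1 quot_scale.
Proof. by move=> v; rewrite -(quot_pi_repr v) -quot_piZ scale1r. Qed.

Lemma quot_scaleDr : right_distributive quot_scale +%R.
Proof.
move=> a u v; rewrite -(quot_pi_repr u) -(quot_pi_repr v).
by rewrite -quot_piD -!quot_piZ scalerDr quot_piD.
Qed.

Lemma quot_scaleDl v : {morph quot_scale^~ v : a b / a + b}.
Proof.
by move=> a b /=; rewrite -(quot_pi_repr v) -!quot_piZ scalerDl quot_piD.
Qed.

HB.instance Definition _ := GRing.Zmodule_isLmodule.Build k quot_alg
  quot_scaleA quot_scale1 quot_scaleDr quot_scaleDl.

(* The closed subscheme of Spec R cut out by the equations A is isomorphic,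
   over k, to an affine space: its coordinate ring is isomorphic, as a
   k-algebra, to a polynomial ring over k. *)
Definition closed_subscheme_is_affine_space : Prop :=
  exists (N : nat) (phi : {rmorphism quot_alg -> {mpoly k[N]}}),
    scalable phi /\ bijective phi.

End IdealQuotient.

Section TermOrders.
Variable n : nat.
Implicit Types (lt : rel 'X_{1..n}) (a b c : 'X_{1..n}).

Record term_order lt : Prop := TermOrder {
  term_irr : irreflexive lt;
  term_trans : transitive lt;
  term_total : forall a b, a != b -> lt a b || lt b a;
  term_add : forall a b c, lt a b -> lt (a + c)%MM (b + c)%MM;
  term_min : forall a, a != 0%MM -> lt 0%MM a }.

Definition tail lt a : set 'X_{1..n} := [set b | lt b a].

Definition htail lt a : set 'X_{1..n} :=
  [set b | lt b a /\ mdeg b = mdeg a].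

Definition reliable lt : Prop := forall a, finite_set (tail lt a).

End TermOrders.

Section Dickson.
Variable n : nat.
Implicit Types (u : nat -> 'X_{1..n}) (lt : rel 'X_{1..n}).

Lemma nat_nondecr_subseq (v : nat -> nat) :
  exists2 f : nat -> nat, (forall i, (f i < f i.+1)%N) &
    forall i, (v (f i) <= v (f i.+1))%N.
Proof.
have minP N : exists p, (N <= p)%N /\ forall r, (N <= r)%N -> (v p <= v r)%N.
  have ex : exists m, `[< exists2 p, (N <= p)%N & v p = m >].
    by exists (v N); apply/asboolP; exists N.
  case: (ex_minnP ex) => m /asboolP[p Np <-] pmin; exists p; split=> // r Nr.
  by apply: pmin; apply/asboolP; exists r.
pose c N := projT1 (cid (minP N)).
have cP N : (N <= c N)%N /\ forall r, (N <= r)%N -> (v (c N) <= v r)%N.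
  exact: projT2 (cid (minP N)).
pose f := fix f i := if i is j.+1 then c (f j).+1 else c 0%N.
have fS i : (f i < f i.+1)%N by have [] := cP (f i).+1.
exists f => // i; case: i => [|i].
  by have [_] := cP 0%N; apply.
have [le1 h] := cP (f i).+1; apply: (h (f i.+2)).
exact: leq_trans le1 (ltnW (fS i.+1)).
Qed.

Lemma dickson_subseq u : exists2 f : nat -> nat,
  (forall i j, (i < j)%N -> (f i < f j)%N) &
  forall i j, (i < j)%N -> (u (f i) <= u (f j))%MM.
Proof.
have hs (s : seq 'I_n) : exists2 f : nat -> nat,
    (forall i j, (i < j)%N -> (f i < f j)%N) &
    forall x, x \in s -> forall i j, (i < j)%N -> (u (f i) x <= u (f j) x)%N.
  elim: s => [|x s [f f_incr fP]]; first by exists id.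
  have [g gS gP] := nat_nondecr_subseq (fun i => u (f i) x).
  have g_incr i j : (i < j)%N -> (g i < g j)%N.
    exact: (homo_ltn ltn_trans).
  exists (f \o g) => [i j /g_incr/f_incr //|y].
  rewrite inE => /orP[/eqP->{y}|/fP yP i j /g_incr /yP //] i j /ltnW.
  apply: (homo_leq (f := fun i => u (f (g i)) x) (r := leq)) => //.
  by move=> ? ? ?; exact: leq_trans.
have [f f_incr fP] := hs (enum 'I_n); exists f => // i j ij.
by apply/mnm_lepP => x; apply: fP => //; rewrite mem_enum.
Qed.

Lemma term_order_wf lt : term_order lt -> well_founded lt.
Proof.
move=> ltP; apply: contrapT => nwf.
have [a0 a0P] : exists a, ~ Acc lt a by apply/existsNP => h; exact: nwf.
have nextP (x : {a | ~ Acc lt a}) : exists y : {a | ~ Acc lt a},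
    lt (projT1 y) (projT1 x).
  case: x => a aP /=; apply: contrapT => h; apply: aP; constructor => b ba.
  by apply: contrapT => bP; apply: h; exists (exist _ b bP).
pose nx x := projT1 (cid (nextP x)).
pose w i := projT1 (iter i nx (exist _ a0 a0P)).
have wS i : lt (w i.+1) (w i) by rewrite /w iterS; exact: projT2 (cid (nextP _)).
have w_decr i j : (i < j)%N -> lt (w j) (w i).
  apply: (homo_ltn (r := fun x y => lt y x)) => // y x z xy yz.
  exact: (term_trans ltP yz xy).
have [f f_incr fle] := dickson_subseq w.
have /w_decr := f_incr 0 1 isT; have /submK := fle 0 1 isT.
set y := w _; set x := w _ => eyx yx.
have [e|/(term_min ltP)/(fun h => term_add ltP x h)] := eqVneq (y - x)%MM 0%MM.
  by move: yx; rewrite -eyx e add0m (term_irr ltP).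
rewrite add0m eyx => xy.
by have := term_trans ltP xy yx; rewrite (term_irr ltP).
Qed.

End Dickson.

Section Stratum.
Variables (k : fieldType) (n : nat).
Variables (J : {pred {mpoly k[n]}}) (tl : 'X_{1..n} -> set 'X_{1..n}).

Definition min_gens : set 'X_{1..n} :=
  [set m | 'X_[m] \in J /\
           forall d, 'X_[d] \in J -> (d <= m)%MM -> d = m].

(* By Dickson's lemma min_gens is finite, so that fset_set min_gens has the
   same elements; they are numbered in an arbitrary way. *)
Definition ngens : nat := #|` fset_set min_gens|.

Definition gen (i : 'I_ngens) : 'X_{1..n} :=
  nth 0%MM (enum_fset (fset_set min_gens)) i.

(* fset_set of an infinite set is empty: this is the intended set only when
   the tails tl (gen i) are finite, i.e. for htail lt, and for tail lt when lt
   is reliable. *)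
Definition gen_tail (i : 'I_ngens) : {fset 'X_{1..n}} :=
  fset_set [set b | tl (gen i) b /\ 'X_[b] \notin J].

Definition cvar : finType := {i : 'I_ngens & gen_tail i}.

Local Notation kC := {mpoly k[#|cvar|]}.

Definition coef_var (i : 'I_ngens) (b : gen_tail i) : kC :=
  'X_(enum_rank (Tagged (fun i => gen_tail i) b : cvar)).

Definition gen_poly (i : 'I_ngens) : {mpoly kC[n]} :=
  'X_[gen i] + \sum_(b : gen_tail i) coef_var b *: 'X_[val b].

Definition spoly (i j : 'I_ngens) : {mpoly kC[n]} :=
  let l := mlcm (gen i) (gen j) in
  'X_[(l - gen i)%MM] * gen_poly i - 'X_[(l - gen j)%MM] * gen_poly j.

(* The leading coefficients of the gen_poly i are 1, so no division of
   coefficients is needed. *)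
Definition reduction_step (f g : {mpoly kC[n]}) : Prop :=
  exists (i : 'I_ngens) (m : 'X_{1..n}),
    (m + gen i)%MM \in msupp f /\
    g = f - f@_(m + gen i)%MM *: ('X_[m] * gen_poly i).

Definition complete_reduction (f h : {mpoly kC[n]}) : Prop :=
  clos_refl_trans _ reduction_step f h /\
  forall b, b \in msupp h -> 'X_[b] \notin J.

Definition spoly_reductions (H : 'I_ngens -> 'I_ngens -> {mpoly kC[n]})
  : Prop :=
  forall i j : 'I_ngens, (i < j)%N -> complete_reduction (spoly i j) (H i j).

Definition stratum_eqs (H : 'I_ngens -> 'I_ngens -> {mpoly kC[n]}) : set kC :=
  [set c | exists (i j : 'I_ngens) (b : 'X_{1..n}),
             (i < j)%N /\ c = (H i j)@_b].

(* The stratum, for every choice of the complete reductions. *)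
Definition stratum_is_affine_space : Prop :=
  forall H, spoly_reductions H ->
    closed_subscheme_is_affine_space (stratum_eqs H).

End Stratum.

Section ReductionsExist.
Variables (k : fieldType) (n : nat) (J : {pred {mpoly k[n]}}).
Variables (lt : rel 'X_{1..n}) (tl : 'X_{1..n} -> set 'X_{1..n}).

Lemma min_gens_finite : finite_set (min_gens J).
Proof.
apply: contrapT => /infiniteP /card_leP[f].
pose u (i : nat) : 'X_{1..n} := set_val (f (to_setT i)).
have um i : min_gens J (u i) by have := set_valP (f (to_setT i)).
have u_inj : injective u.
  move=> i j /val_inj /(inj (mem_set I) (mem_set I)) e.
  by have := congr1 set_val e.
have [g g_incr gle] := dickson_subseq u.
have /u_inj e := (um (g 1)).2 (u (g 0)) (um _).1 (gle 0 1 isT).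
by have := g_incr 0 1 isT; rewrite e ltnn.
Qed.

Lemma gen_dvd m : 'X_[m] \in J -> exists i : 'I_(ngens J), (gen i <= m)%MM.
Proof.
elim/(ltn_ind) : {m}(mdeg m) {-2}m (erefl (mdeg m)) => d IH m md mJ.
have [mm|nm] := pselect (min_gens J m).
  have ms : m \in enum_fset (fset_set (min_gens J)).
    by have := mem_set mm; rewrite -(in_fset_set min_gens_finite).
  have im : (index m (enum_fset (fset_set (min_gens J))) < ngens J)%N.
    by rewrite index_mem.
  by exists (Ordinal im); rewrite /gen /= nth_index // lepm_refl.
have [e /not_implyP[eJ /not_implyP[em nem]]] :
    exists e, ~ ('X_[e] \in J -> (e <= m)%MM -> e = m).
  by apply/existsNP => h; apply: nm.
have ltd : (mdeg e < d)%N.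
  rewrite -md -(submK em) mdegD -[X in (X < _)%N]add0n ltn_add2r lt0n mdeg_eq0.
  by apply/eqP => h; apply: nem; rewrite -(submK em) h add0m.
have [i ie] := IH _ ltd e erefl eJ.
by exists i; exact: lepm_trans ie em.
Qed.

Lemma gen_tailW (i : 'I_(ngens J)) b : b \in gen_tail tl i ->
  tl (gen i) b /\ 'X_[b] \notin J.
Proof.
rewrite /gen_tail; set A := [set _ | _].
have [fA|nfA] := pselect (finite_set A); first by rewrite in_fset_set // => /set_mem.
by rewrite /fset_set; case: pselect.
Qed.

(* Hence the quantification over complete reductions in
   stratum_is_affine_space is never vacuous, for tail lt and for htail lt. *)
Lemma complete_reduction_exists : term_order lt ->
  (forall a, tl a `<=` tail lt a) ->
  forall f : {mpoly {mpoly k[#|cvar J tl|]}[n]},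
  exists h, complete_reduction f h.
Proof.
move=> ltP tlP.
have step (f : {mpoly {mpoly k[#|cvar J tl|]}[n]}) : complete_reduction f f \/
    exists g b0, [/\ reduction_step f g, b0 \in msupp f, 'X_[b0] \in J &
      forall b, b \in msupp g -> 'X_[b] \in J -> lt b b0].
  pose s := [seq b <- msupp f | 'X_[b] \in J].
  have [s0|sN0] := eqVneq s [::].
    left; split; first exact: rt_refl.
    move=> b bf; apply/negP => bJ.
    have bs : b \in s by rewrite mem_filter bJ.
    by rewrite s0 in bs.
  have [b0 b0s b0max] : exists2 b0, b0 \in s &
      forall b, b \in s -> b != b0 -> lt b b0.
    elim: (s) sN0 => // x [|y t] IHt _.
      by exists x; rewrite ?inE // => b; rewrite !inE => /eqP->; rewrite eqxx.
    have [//|b0 b0s b0max] := IHt.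
    have [xb|/(term_total ltP)/orP[xb|bx]] := eqVneq x b0.
    - exists b0; first by rewrite inE b0s orbT.
      by move=> b; rewrite inE xb => /orP[->//|]; exact: b0max.
    - exists b0; first by rewrite inE b0s orbT.
      by move=> b; rewrite inE => /orP[/eqP->//|]; exact: b0max.
    exists x; first by rewrite inE eqxx.
    move=> b; rewrite inE => /orP[->//|bs _].
    have [->//|nb] := eqVneq b b0.
    exact: (term_trans ltP (b0max b bs nb) bx).
  move: (b0s); rewrite mem_filter => /andP[b0J b0f].
  have [i /submK ib] := gen_dvd b0J.
  set c := (b0 - gen i)%MM in ib.
  pose g := f - f@_(c + gen i)%MM *: ('X_[c] * gen_poly tl i).
  have fg : reduction_step f g by exists i, c; split=> //; rewrite ib.
  have gb0 b : b \in msupp g -> 'X_[b] \in J -> lt b b0.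
    move=> bg bJ; have gpE : 'X_[c] * gen_poly tl i =
        'X_[b0] + \sum_(d : gen_tail tl i) coef_var d *: 'X_[(c + val d)%MM].
      rewrite /gen_poly mulrDr -mpolyXD ib mulr_sumr; congr (_ + _).
      by apply: eq_bigr => d _; rewrite -scalerAr -mpolyXD.
    have bc d : d \in gen_tail tl i -> lt (c + d)%MM b0.
      move=> di; rewrite -ib ![(c + _)%MM]addmC; apply: (term_add ltP).
      by have [/tlP] := gen_tailW di.
    have [bb0|nbb0] := eqVneq b b0.
      move: bg; rewrite mcoeff_msupp bb0 /g ib gpE mcoeffB mcoeffZ mcoeffD.
      rewrite mcoeffX eqxx raddf_sum /= big1 ?addr0 ?mulr1 ?subrr ?eqxx //.
      move=> d _; rewrite mcoeffZ mcoeffX; case: eqP => [e|]; last by rewrite mulr0.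
      by have := bc _ (valP d); rewrite e (term_irr ltP).
    have [bf|bf] := boolP (b \in msupp f).
      by apply: b0max => //; rewrite mem_filter bJ.
    have [[d di ->]|nd] := pselect (exists2 d, d \in gen_tail tl i & b = (c + d)%MM).
      exact: bc.
    move: bg; rewrite mcoeff_msupp /g mcoeffB (memN_msupp_eq0 bf) gpE mcoeffZ.
    rewrite mcoeffD mcoeffX [b0 == b]eq_sym (negPf nbb0) raddf_sum /= big1 ?addr0 ?mulr0 ?subrr ?eqxx //.
    move=> d _; rewrite mcoeffZ mcoeffX; case: eqP => [e|]; last by rewrite mulr0.
    by case: nd; exists (val d); [exact: valP|].
  by right; exists g, b0.
have stepE (f g h : {mpoly {mpoly k[#|cvar J tl|]}[n]}) :
    reduction_step f g -> complete_reduction g h -> complete_reduction f h.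
  by move=> fg [gh hJ]; split=> //; apply: rt_trans gh; exact: rt_step.
have red m : forall f : {mpoly {mpoly k[#|cvar J tl|]}[n]},
    (forall b, b \in msupp f -> 'X_[b] \in J -> lt b m) ->
    exists h, complete_reduction f h.
  elim/(well_founded_ind (term_order_wf ltP)): m => m IH f fm.
  have [|[g [b0 [fg b0f b0J /(IH _ (fm _ b0f b0J))[h gh]]]]] := step f.
    by exists f.
  by exists h; exact: stepE gh.
move=> f; have [|[g [b0 [fg b0f b0J /red[h gh]]]]] := step f; first by exists f.
by exists h; exact: stepE gh.
Qed.

End ReductionsExist.

Section IdealJ.
(* Only the values a 1, ..., a q are used. *)
Variables (k : fieldType) (n q : nat) (a : nat -> nat).

Definition idealJ_s : nat := find (fun s => a s.+1 != 0%N) (iota 0 q).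

Definition idealJ_prod (i : nat) : {mpoly k[n.+1]} :=
  \prod_(i <= j < q.+1) 'X_(inord (n - j)) ^+ a j.

Definition idealJ_gens : set {mpoly k[n.+1]} :=
  [set g | (exists2 i : nat, (idealJ_s.+2 <= i <= q)%N &
              g = 'X_(inord (n - i)) * idealJ_prod i)
           \/ g = idealJ_prod idealJ_s.+1].

Definition idealJ : {pred {mpoly k[n.+1]}} := ideal_gen idealJ_gens.

End IdealJ.

Arguments idealJ k n q a : clear implicits.

(* Main.v *)
Require Import Defs.
From HB Require Import structures.
From Stdlib Require Import Relation_Operators.
From mathcomp Require Import all_boot all_order all_algebra finmap.
From mathcomp Require Import boolp classical_sets cardinality.
From mathcomp Require Import mpoly ssrcomplements.
From mathcomp Require Import ring zify.

(* Write J = y^a ((y) + J'), where J' does not involve y and has the same shape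
   with one variable less. Over any commutative ring, a family of ideals with
   initial ideal J factors as F ((L) + I'), where F is monic with leading
   monomial y^a, L = y - t with t free of y, and I' is a family with initial
   ideal J' in the remaining variables. To find t and F, take as generators of
   I' the coefficients p_i of y^a in the generators f_i of I other than the one,
   f_0, with leading monomial y^(a+1). The S-pairs express y f_i - p_i f_0 as a
   combination of the f_j, and the structure of I' (which is principal, or a
   principal ideal times an ideal containing two elements with coprime leading
   monomials) forces y f_i - p_i f_0 = t f_i for one t; dividing f_0 by y - t
   gives f_0 = (y - t) F and f_i = p_i F. Conversely all such products are
   standard bases, and they are automatically reduced when t is parametrised by
   the coefficient e of y^a in f_0. So the coefficients of F and e, at all
   levels, are free coordinates on the stratum: applied to the coordinate ring
   of the stratum and to a polynomial ring, the factorization gives mutually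
   inverse morphisms. *)

Set Implicit Arguments.
Unset Strict Implicit.
Unset Printing Implicit Defensive.

Import GRing.Theory.

Local Open Scope ring_scope.

(** * Polynomials with restricted support *)

Section Supports.
Variables (n : nat) (A : comNzRingType).
Implicit Types (p q : {mpoly A[n]}) (P Q S : 'X_{1..n} -> Prop) (m b : 'X_{1..n}).

Definition supported P p := forall b, b \in msupp p -> P b.

Lemma supportedW P Q p : (forall b, P b -> Q b) -> supported P p -> supported Q p.
Proof. by move=> PQ hp b /hp/PQ. Qed.

Lemma supported0 P : supported P (0 : {mpoly A[n]}).
Proof. by move=> b; rewrite msupp0. Qed.

Lemma supportedD P p q : supported P p -> supported P q -> supported P (p + q).
Proof. by move=> hp hq b /msuppD_le; rewrite mem_cat => /orP[/hp|/hq]. Qed.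

Lemma supportedZ P (c : A) p : supported P p -> supported P (c *: p).
Proof. by move=> hp b /msuppZ_le/hp. Qed.

Lemma supportedN P p : supported P p -> supported P (- p).
Proof. by move=> hp b; rewrite (perm_mem (msuppN p)) => /hp. Qed.

Lemma supportedB P p q : supported P p -> supported P q -> supported P (p - q).
Proof. by move=> hp hq; apply: supportedD => //; apply: supportedN. Qed.

Lemma supported_sum (I : eqType) (s : seq I) (F : I -> {mpoly A[n]}) P :
  (forall i, i \in s -> supported P (F i)) -> supported P (\sum_(i <- s) F i).
Proof.
rewrite big_seq => h; apply: (big_ind (supported P)) => //.
  exact: supported0.
by move=> ? ?; exact: supportedD.
Qed.

Lemma supportedX P m : P m -> supported P ('X_[m] : {mpoly A[n]}).
Proof. by move=> Pm b; rewrite msuppX inE => /eqP->. Qed.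

Lemma supportedM P Q S p q : (forall b c, P b -> Q c -> S (b + c)%MM) ->
  supported P p -> supported Q q -> supported S (p * q).
Proof.
move=> h hp hq b /msuppM_le /allpairsP[[c1 c2] /= [/hp ? /hq ? ->]].
exact: h.
Qed.

Lemma supportedI P Q p : supported P p -> supported Q p ->
  supported (fun b => P b /\ Q b) p.
Proof. by move=> hp hq b hb; split; [apply: hp|apply: hq]. Qed.

Lemma supported_coef0 P p b : supported P p -> ~ P b -> p@_b = 0.
Proof.
move=> hp nPb; apply/eqP; rewrite mcoeff_eq0; apply/negP => /hp; exact: nPb.
Qed.

(** If [m1 + m2] splits in only one way over the two supports, one product of terms contributes to
    the coefficient. No cancellation law in [A] is involved, so zero divisors are harmless. *)
Lemma mcoeffM_unique p q m1 m2 :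
  (forall b1 b2, b1 \in msupp p -> b2 \in msupp q ->
     (b1 + b2 = m1 + m2)%MM -> b1 = m1 /\ b2 = m2) ->
  (p * q)@_(m1 + m2)%MM = p@_m1 * q@_m2.
Proof.
move=> h; rewrite mpolyME raddf_sum /= big_allpairs_dep /=.
have z b1 b2 : b1 \in msupp p -> b2 \in msupp q -> (b1, b2) != (m1, m2) ->
    ((p@_b1 * q@_b2) *: 'X_[(b1 + b2)%MM] : {mpoly A[n]})@_(m1 + m2)%MM = 0.
  move=> hb1 hb2 ne; rewrite mcoeffZ mcoeffX; case: eqP => [e|]; last by rewrite mulr0.
  by have [e1 e2] := h _ _ hb1 hb2 e; rewrite e1 e2 eqxx in ne.
have [m1p|m1p] := boolP (m1 \in msupp p); last first.
  rewrite (memN_msupp_eq0 m1p) mul0r big_seq big1 // => b1 hb1.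
  rewrite big_seq big1 // => b2 hb2; apply: z => //; apply: contraNneq m1p.
  by case=> <-.
have [m2q|m2q] := boolP (m2 \in msupp q); last first.
  rewrite (memN_msupp_eq0 m2q) mulr0 big_seq big1 // => b1 hb1.
  rewrite big_seq big1 // => b2 hb2; apply: z => //; apply: contraNneq m2q.
  by case=> _ <-.
rewrite (bigD1_seq m1) ?msupp_uniq //= [X in _ + X]big1_seq; last first.
  move=> b1 /andP[ne hb1]; rewrite big1_seq // => b2 hb2; apply: z => //.
  by apply: contraNneq ne; case=> ->.
rewrite (bigD1_seq m2) ?msupp_uniq //= [X in _ + X + _]big1_seq; last first.
  by move=> b2 /andP[ne hb2]; apply: z => //; apply: contraNneq ne; case=> ->.
by rewrite mcoeffZ mcoeffX eqxx mulr1 !addr0.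
Qed.

(** The linear extension of a map on monomials; the extraction of coefficients [ycoef] and the
    normal form in Buchberger's criterion are both obtained this way. *)
Definition mlin (M : lmodType A) (phi : 'X_{1..n} -> M) p : M :=
  \sum_(m <- msupp p) p@_m *: phi m.

Lemma mlinE (M : lmodType A) (phi : 'X_{1..n} -> M) p k : (msize p <= k)%N ->
  mlin phi p = \sum_(m : 'X_{1..n < k}) p@_m *: phi m.
Proof.
move=> hk; rewrite /mlin (big_mksub 'X_{1..n < k}) /=; first last.
- by move=> m /msize_mdeg_lt /leq_trans; apply.
- exact: msupp_uniq.
by rewrite big_rmcond //= => m /memN_msupp_eq0->; rewrite scale0r.
Qed.

Lemma mlin_is_linear (M : lmodType A) (phi : 'X_{1..n} -> M) : linear (mlin phi).
Proof.
(* A common degree bound gives the three sums the same index set, so linearity is checked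
   termwise. *)
move=> c p q; pose k := maxn (msize (c *: p + q)) (maxn (msize p) (msize q)).
rewrite !(@mlinE _ _ _ k) ?leq_max ?leqnn ?orbT // scaler_sumr -big_split /=.
by apply: eq_bigr => m _; rewrite mcoeffD mcoeffZ scalerDl scalerA.
Qed.

HB.instance Definition _ (M : lmodType A) (phi : 'X_{1..n} -> M) :=
  GRing.isLinear.Build A {mpoly A[n]} M *:%R (mlin phi) (mlin_is_linear phi).

Lemma mlinX (M : lmodType A) (phi : 'X_{1..n} -> M) m : mlin phi 'X_[m] = phi m.
Proof. by rewrite /mlin msuppX big_seq1 mcoeffX eqxx scale1r. Qed.

Lemma supported_ind P (K : {mpoly A[n]} -> Prop) : K 0 ->
  (forall p q, K p -> K q -> K (p + q)) ->
  (forall c p, K p -> K (c *: p)) ->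
  (forall m, P m -> K 'X_[m]) -> forall p, supported P p -> K p.
Proof.
move=> K0 KD KZ KX p hp; rewrite [p]mpolyE big_seq.
apply: (big_ind K) => // m hm; apply: KZ; apply: KX; exact: hp.
Qed.

End Supports.

(** * Polynomials free of given variables, and coefficients of powers of one variable *)

Section FreeOfVariables.
Variables (n : nat) (A : comNzRingType).
Implicit Types (p q : {mpoly A[n]}) (m b : 'X_{1..n}) (V : seq 'I_n) (y : 'I_n).

(** In the recursion over levels, [V] lists the variables of the levels already treated; the ideals
    of the current level live in the remaining variables. *)
Definition mfree V m : Prop := forall z, z \in V -> m z = 0%N.
Definition vfree V p : Prop := supported (mfree V) p.

Lemma mfreeD V b c : mfree V b -> mfree V c -> mfree V (b + c)%MM.
Proof. by move=> hb hc z zV; rewrite mnmDE hb ?hc. Qed.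

Lemma mfree_le V b c : (b <= c)%MM -> mfree V c -> mfree V b.
Proof.
by move=> /mnm_lepP le hc z zV; apply/eqP; rewrite -leqn0 -(hc z zV).
Qed.

Lemma mfree_cons y V m : m y = 0%N -> mfree V m -> mfree (y :: V) m.
Proof. by move=> h hV z; rewrite inE => /orP[/eqP->|/hV]. Qed.

Lemma mfree_consW y V m : mfree (y :: V) m -> mfree V m.
Proof. by move=> h z zV; apply: h; rewrite inE zV orbT. Qed.

Lemma mfree_head y V m : mfree (y :: V) m -> m y = 0%N.
Proof. by move=> h; apply: h; rewrite inE eqxx. Qed.

Lemma vfreeM V p q : vfree V p -> vfree V q -> vfree V (p * q).
Proof. by apply: supportedM; exact: mfreeD. Qed.

Lemma vfree_consW y V p : vfree (y :: V) p -> vfree V p.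
Proof. by apply: supportedW; exact: mfree_consW. Qed.

Lemma mulm_yE y a : (U_(y) *+ a)%MM y = a.
Proof. by rewrite mulmnE mnm1E eqxx mul1n. Qed.

Lemma mulm_yNE y a z : z != y -> (U_(y) *+ a)%MM z = 0%N.
Proof. by move=> h; rewrite mulmnE mnm1E eq_sym (negPf h). Qed.

Lemma mfree_mulm V y a : y \notin V -> mfree V (U_(y) *+ a)%MM.
Proof. by move=> h z zV; apply: mulm_yNE; apply: contraNneq h => <-. Qed.

Lemma mulm_y_le y a m : (U_(y) *+ a <= m)%MM = (a <= m y)%N.
Proof.
apply/mnm_lepP/idP => [/(_ y)|h z]; first by rewrite mulm_yE.
by have [->|/mulm_yNE->//] := eqVneq z y; rewrite mulm_yE.
Qed.

Definition ydeg_le y a p := supported (fun b => (b y <= a)%N) p.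

Lemma ydeg_le_free y V p a : vfree (y :: V) p -> ydeg_le y a p.
Proof. by apply: supportedW => b /mfree_head->. Qed.

Lemma ydeg_leMr y V a p q : ydeg_le y a p -> vfree (y :: V) q -> ydeg_le y a (p * q).
Proof. by apply: supportedM => b c hb /mfree_head hc; rewrite mnmDE hc addn0. Qed.

(** The coefficient of [y ^ a] when a polynomial is regarded as a polynomial in [y] over the other
    variables. *)
Definition ycoef y a : {mpoly A[n]} -> {mpoly A[n]} :=
  mlin (fun m => if m y == a then 'X_[(m - U_(y) *+ a)%MM] else 0).

HB.instance Definition _ y a := GRing.Linear.on (ycoef y a).

Lemma ycoefX y a m :
  ycoef y a 'X_[m] = if m y == a then 'X_[(m - U_(y) *+ a)%MM] else 0.
Proof. exact: mlinX. Qed.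

Lemma mcoeff_ycoef y a p m :
  (ycoef y a p)@_m = if m y == 0%N then p@_(m + U_(y) *+ a)%MM else 0.
Proof.
apply: (@supported_ind _ _ (fun _ => True) (fun p => (ycoef y a p)@_m =
  if m y == 0%N then p@_(m + U_(y) *+ a)%MM else 0)) => //.
- by rewrite raddf0 !mcoeff0; case: ifP.
- by move=> q r hq hr; rewrite raddfD !mcoeffD hq hr; case: ifP; rewrite ?addr0.
- by move=> c q hq; rewrite linearZ /= !mcoeffZ hq; case: ifP; rewrite ?mulr0.
move=> b _; rewrite ycoefX; case: (eqVneq (b y) a) => [by_|by_].
  rewrite !mcoeffX; case: (eqVneq (m y) 0%N) => [my|my].
    have le : (U_(y) *+ a <= b)%MM by rewrite mulm_y_le by_.
    by rewrite -(eqm_add2r (U_(y) *+ a)%MM (b - _)%MM) submK.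
  case: eqP => // e; case/eqP: my; rewrite -e mnmBE mulm_yE by_ subnn //.
rewrite mcoeff0 mcoeffX; case: (m y =P 0%N) => // my; case: eqP => // e.
by case/eqP: by_; rewrite e mnmDE my mulm_yE.
Qed.

Lemma ycoef_free y a V p : vfree V p -> vfree (y :: V) (ycoef y a p).
Proof.
move=> hp b; rewrite mcoeff_msupp mcoeff_ycoef.
case: (eqVneq (b y) 0%N) => [h nz|_]; last by rewrite eqxx.
apply: mfree_cons => //; apply: (mfree_le (lem_addr _ (U_(y) *+ a)%MM)).
by apply: hp; rewrite mcoeff_msupp.
Qed.

Lemma ycoefMl y a V c p : vfree (y :: V) c -> ycoef y a (c * p) = c * ycoef y a p.
Proof.
move=> hc; move: c hc.
apply: (@supported_ind _ _ _ (fun c => ycoef y a (c * p) = c * ycoef y a p)).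
- by rewrite !mul0r raddf0.
- by move=> c d hc hd; rewrite !mulrDl raddfD /= hc hd.
- by move=> k c hc; rewrite -!scalerAl linearZ /= hc.
move=> m /mfree_head my.
apply: (@supported_ind _ _ (fun _ => True)
  (fun p => ycoef y a ('X_[m] * p) = 'X_[m] * ycoef y a p)) => //.
- by rewrite raddf0 !mulr0 raddf0.
- by move=> c d hc hd; rewrite mulrDr !raddfD /= hc hd mulrDr.
- by move=> k c hc; rewrite -scalerAr !linearZ /= hc scalerAr.
move=> b _; rewrite -mpolyXD !ycoefX mnmDE my add0n; case: eqP => by_; last by rewrite mulr0.
rewrite -mpolyXD; congr 'X_[_].
by rewrite addmBA // mulm_y_le by_.
Qed.

Lemma ycoef_lt y a p : supported (fun b => (b y < a)%N) p -> ycoef y a p = 0.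
Proof.
move=> hp; apply/mpolyP => m; rewrite mcoeff_ycoef mcoeff0; case: eqP => // my.
by apply: (supported_coef0 hp); rewrite mnmDE my mulm_yE ltnn.
Qed.

Lemma ydeg_le_pred y a p : ydeg_le y a.+1 p -> ycoef y a.+1 p = 0 -> ydeg_le y a p.
Proof.
move=> hp h b bp; have := hp b bp; rewrite leq_eqVlt => /orP[/eqP by_|//].
have := congr1 (mcoeff (b - U_(y) *+ a.+1)%MM) h.
rewrite mcoeff_ycoef mnmBE mulm_yE by_ subnn eqxx mcoeff0 submK ?mulm_y_le ?by_ //.
by move/eqP; rewrite mcoeff_eq0 bp.
Qed.

End FreeOfVariables.

(** * Term orders and leading monomials *)

Section TermOrderFacts.
Variables (n : nat) (lt : rel 'X_{1..n}) (ltP : term_order lt).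
Implicit Types (a b c m : 'X_{1..n}) (s : seq 'X_{1..n}).

Lemma lt_asym a b : lt a b -> lt b a = false.
Proof.
move=> ab; apply/negP => ba; have := term_trans ltP ab ba.
by rewrite (term_irr ltP).
Qed.

Lemma lt_add2r a b c : lt (a + c)%MM (b + c)%MM = lt a b.
Proof.
apply/idP/idP => [h|]; last exact: term_add.
have [e|/(term_total ltP)/orP[//|/(term_add ltP) ba]] := eqVneq a b.
  by move: h; rewrite e (term_irr ltP).
by move: (lt_asym h); rewrite ba.
Qed.

Lemma lt_add2l a b c : lt (c + a)%MM (c + b)%MM = lt a b.
Proof. by rewrite ![(c + _)%MM]addmC lt_add2r. Qed.

Lemma lem_ltF a b : (a <= b)%MM -> lt b a = false.
Proof.
move=> /submK <-; rewrite -[X in lt _ X]add0m lt_add2r.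
have [->|/(term_min ltP)/lt_asym//] := eqVneq (b - a)%MM 0%MM.
exact: (term_irr ltP).
Qed.

(** A monomial of [y]-degree at least [k] is a multiple of [y ^ k], hence not smaller in any term
    order. Thus a polynomial led by a power of [y] is monic in [y]. *)
Lemma lt_ydeg b y k : lt b (U_(y) *+ k)%MM -> (b y < k)%N.
Proof. by move=> h; rewrite ltnNge -mulm_y_le; apply/negP => /lem_ltF; rewrite h. Qed.

Lemma lt_max s : s != [::] ->
  exists2 m, m \in s & forall b, b \in s -> b = m \/ lt b m.
Proof.
elim: s => // x [|y t] IHt _.
  by exists x; rewrite ?inE // => b; rewrite !inE => /eqP->; left.
have [//|m ms mmax] := IHt.
have [xm|/(term_total ltP)/orP[xm|mx]] := eqVneq x m.
- exists m; first by rewrite inE ms orbT.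
  by move=> b; rewrite inE xm => /orP[/eqP|/mmax]; [left|].
- exists m; first by rewrite inE ms orbT.
  by move=> b; rewrite inE => /orP[/eqP->|/mmax //]; right.
exists x; first by rewrite inE eqxx.
move=> b; rewrite inE => /orP[/eqP->|/mmax[->|bm]]; [by left|by right|right].
exact: (term_trans ltP bm mx).
Qed.

End TermOrderFacts.

(** What [htail lt] has in common with [tail lt] for a reliable order, so that one argument covers
    both strata. *)
Record tail_order n (lt : rel 'X_{1..n}) (tl : 'X_{1..n} -> set 'X_{1..n}) : Prop :=
  TailOrder {
    tl_lt : forall a b, tl a b -> lt b a;
    tl_trans : forall a b c, tl a b -> tl b c -> tl a c;
    tl_add : forall a b c, tl (a + c)%MM (b + c)%MM <-> tl a b;
    tl_fin : forall a, finite_set (tl a) }.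

Lemma htail_order n (lt : rel 'X_{1..n}) : term_order lt -> tail_order lt (htail lt).
Proof.
move=> ltP; split=> [a b []|a b c [ba eba] [cb ecb]|a b c|a] //.
- by split; [exact: (term_trans ltP cb ba)|rewrite ecb].
- rewrite /htail /= (lt_add2r ltP) !mdegD; split=> [[ba /eqP]|[ba ->]] //.
  by rewrite eqn_add2r => /eqP.
pose T := [fset val m | m : 'X_{1..n < (mdeg a).+1}]%fset.
apply: (@sub_finite_set _ _ [set` T]); last exact: finite_fset.
move=> b [_ e]; have hb : (mdeg b < (mdeg a).+1)%N by rewrite e.
by apply/imfsetP; exists (BMultinom hb).
Qed.

Lemma reliable_tail_order n (lt : rel 'X_{1..n}) : term_order lt -> reliable lt ->
  tail_order lt (tail lt).
Proof.
move=> ltP rel; split=> // [a b c ba cb|a b c].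
  exact: (term_trans ltP cb ba).
by rewrite /tail /= (lt_add2r ltP).
Qed.

(** * Polynomials with a prescribed leading monomial and tail *)

Section Monic.
Variables (n : nat) (lt : rel 'X_{1..n}) (tl : 'X_{1..n} -> set 'X_{1..n}).
Hypotheses (ltP : term_order lt) (tlP : tail_order lt tl).
Variable (A : comNzRingType).
Implicit Types (a b c g h m : 'X_{1..n}) (p q : {mpoly A[n]}).

Definition tmonic g p := p@_g = 1 /\ supported (fun b => b = g \/ tl g b) p.

Lemma tl_irr a : ~ tl a a.
Proof. by move/(tl_lt tlP); rewrite (term_irr ltP). Qed.

Lemma tl_addl a b c : tl (c + a)%MM (c + b)%MM <-> tl a b.
Proof. by rewrite ![(c + _)%MM]addmC; exact: (tl_add tlP). Qed.

Lemma tl_addW a b c d : b = a \/ tl a b -> d = c \/ tl c d ->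
  (b + d)%MM = (a + c)%MM \/ tl (a + c)%MM (b + d)%MM.
Proof.
move=> [->|ba] [->|dc]; [by left|right|right|right].
- exact/tl_addl.
- exact/(tl_add tlP).
apply: (tl_trans tlP (b := (b + c)%MM)); first exact/(tl_add tlP).
exact/tl_addl.
Qed.

Lemma tmonic_tl g p : tmonic g p <->
  exists2 r, p = 'X_[g] + r & supported (tl g) r.
Proof.
split=> [[pg hp]|[r -> hr]].
  exists (p - 'X_[g]); first by rewrite addrC subrK.
  move=> b; rewrite mcoeff_msupp mcoeffB mcoeffX; case: (g =P b) => [<-|ne].
    by rewrite pg subrr eqxx.
  by rewrite subr0 -mcoeff_msupp => /hp[e|//]; case: ne.
split; last first.
  apply: supportedD; first by apply: supportedX; left.
  by apply: supportedW hr; right.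
by rewrite mcoeffD mcoeffX eqxx (supported_coef0 hr) ?addr0 //; exact: tl_irr.
Qed.

(** Any other contribution to the coefficient of [g + m] is a product [b1 + b2] with [b1] in the
    tail of [g]; then [m] is smaller than [b2] and [g + m] lies in the tail of [g + b2], which the
    hypothesis forbids. *)
Lemma mcoeff_tmonicM g p q m : tmonic g p ->
  (forall b, b \in msupp q -> lt m b -> ~ tl (g + b)%MM (g + m)%MM) ->
  (p * q)@_(g + m)%MM = q@_m.
Proof.
move=> [pg hp] hq; rewrite mcoeffM_unique ?pg ?mul1r // => b1 b2 hb1 hb2 e.
have [e1|t1] := hp _ hb1.
  by split=> //; apply/(@addmI _ g); rewrite -e e1.
case: (hq b2 hb2); last by rewrite -e; exact/(tl_add tlP).
by rewrite -(lt_add2l ltP _ _ g) -e (lt_add2r ltP); exact: (tl_lt tlP).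
Qed.

(* The leading term of the product survives because [p] has leading
   coefficient 1, even when [A] has zero divisors. *)
Lemma tmonicM_lead g p q : tmonic g p -> q != 0 ->
  exists2 m, m \in msupp q & (p * q)@_(g + m)%MM = q@_m.
Proof.
move=> hp; rewrite -msupp_eq0 => /(lt_max ltP)[m mq mmax].
exists m => //; apply: mcoeff_tmonicM => // b /mmax[->|bm mb].
  by rewrite (term_irr ltP).
by move: (lt_asym ltP bm); rewrite mb.
Qed.

Lemma tmonic_reg g p q : tmonic g p -> p * q = 0 -> q = 0.
Proof.
move=> hp pq; apply/eqP; apply: contraT => /(tmonicM_lead hp)[m].
by rewrite mcoeff_msupp pq mcoeff0 => /eqP mq /esym/mq.
Qed.

Lemma tmonic_cancel g p q r : tmonic g p -> p * q = p * r -> q = r.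
Proof.
move=> hp e; apply/eqP; rewrite -subr_eq0; apply/eqP/(tmonic_reg hp).
by rewrite mulrBr e subrr.
Qed.

Lemma tmonicM g h p q : tmonic g p -> tmonic h q -> tmonic (g + h)%MM (p * q).
Proof.
move=> hp [qh hq]; split.
  rewrite mcoeff_tmonicM // => b /hq[->|/(tl_lt tlP) bh hb].
    by rewrite (term_irr ltP).
  by move: (lt_asym ltP bh); rewrite hb.
by apply: supportedM hp.2 hq => b c; exact: tl_addW.
Qed.

Lemma tmonic_div g h p q : tmonic g p -> tmonic (g + h)%MM (p * q) -> tmonic h q.
Proof.
move=> hp [pqh hpq].
have hq : supported (fun b => b = h \/ tl h b) q.
  (* The largest monomial [m] of [q] that is neither [h] nor in its tail survives in [p * q]: a
     monomial [b] of [q] with [m] in its tail would be a larger bad monomial, or would put [m] in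
     the tail of [h] by transitivity. *)
  apply: contrapT => nq.
  pose s := [seq b <- msupp q | `[< ~ (b = h \/ tl h b) >]].
  have [|m] := @lt_max _ _ ltP s.
    apply/eqP => s0; apply: nq => b bq; apply: contrapT => nb.
    suff: b \in s by rewrite s0.
    by rewrite mem_filter bq andbT; apply/asboolP.
  rewrite mem_filter => /andP[/asboolP nm mq] mmax.
  have e : (p * q)@_(g + m)%MM = q@_m.
    apply: mcoeff_tmonicM => // b bq mb /tl_addl bm.
    have [bs|] := boolP (b \in s).
      have [eb|] := mmax b bs; first by move: mb; rewrite eb (term_irr ltP).
      by move/(lt_asym ltP); rewrite mb.
    rewrite mem_filter bq andbT => /asboolPn/contrapT[eb|tb]; apply: nm; right.
      by rewrite -eb.
    exact: (tl_trans tlP tb bm).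
  have : (g + m)%MM \in msupp (p * q) by rewrite mcoeff_msupp e -mcoeff_msupp.
  by move=> /hpq[/addmI|/tl_addl] ?; apply: nm; [left|right].
split=> //; rewrite -pqh mcoeff_tmonicM // => b /hq[->|/(tl_lt tlP) bh hb].
  by rewrite (term_irr ltP).
by move: (lt_asym ltP bh); rewrite hb.
Qed.

End Monic.

(** * The monomial ideals and their standard bases *)

Section MonomialIdeal.
Variable n : nat.
Implicit Types (m b g h : 'X_{1..n}) (V : seq 'I_n) (y : 'I_n) (v : seq ('I_n * nat)).

(* The sequence [v = (y, a) :: v'] encodes J(v) = y^a ((y) + J(v')), with
   J([::]) = 0. The ideal J(a_q, ..., a_1) is obtained by decreasing by one the
   last non-zero exponent. *)
Fixpoint inJ v m : bool :=
  if v is (y, a) :: v' then (a < m y)%N || ((m y == a) && inJ v' m) else false.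

Fixpoint gens v : seq 'X_{1..n} :=
  if v is (y, a) :: v' then
    (U_(y) *+ a.+1)%MM :: [seq (U_(y) *+ a + h)%MM | h <- gens v']
  else [::].

Definition genJ v (l : nat) : 'X_{1..n} := nth 0%MM (gens v) l.

Definition fresh V v : Prop :=
  uniq (unzip1 v) /\ forall z, z \in V -> z \notin unzip1 v.

Lemma fresh_cons V y a v : fresh V ((y, a) :: v) ->
  [/\ fresh (y :: V) v, y \notin V & y \notin unzip1 v].
Proof.
move=> [/= /andP[yv uv] hV]; split=> //; last first.
  by apply/negP => /hV; rewrite inE eqxx.
split=> // z; rewrite inE => /orP[/eqP->//|/hV].
by rewrite inE negb_or => /andP[].
Qed.

Lemma size_gens v : size (gens v) = size v.
Proof. by elim: v => //= -[y a] v IH; rewrite /= size_map IH. Qed.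

Lemma genJ_mem v l : (l < size v)%N -> genJ v l \in gens v.
Proof. by move=> h; apply: mem_nth; rewrite size_gens. Qed.

Lemma genJS y a v l : (l < size v)%N ->
  genJ ((y, a) :: v) l.+1 = (U_(y) *+ a + genJ v l)%MM.
Proof. by move=> h; rewrite /genJ /= (nth_map 0%MM) // size_gens. Qed.

Lemma gens_free V v h : (forall z, z \in V -> z \notin unzip1 v) ->
  h \in gens v -> mfree V h.
Proof.
elim: v h => //= -[y a] v IH h hV.
have yV : y \notin V by apply/negP => /hV; rewrite inE eqxx.
rewrite inE => /orP[/eqP->|/mapP[g hg ->]]; first exact: mfree_mulm.
apply: mfreeD; first exact: mfree_mulm.
by apply: IH => // z /hV; rewrite inE negb_or => /andP[].
Qed.

Lemma genJ_free V v l : fresh V v -> (l < size v)%N -> mfree V (genJ v l).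
Proof. by move=> [_ h] /genJ_mem; apply: gens_free. Qed.

Lemma inJ_shift y a v m : y \notin unzip1 v -> inJ v (m + U_(y) *+ a)%MM = inJ v m.
Proof.
elim: v => //= -[z b] v IH; rewrite inE negb_or => /andP[yz /IH ->].
by rewrite mnmDE (mulm_yNE (y := y)) ?addn0 // eq_sym.
Qed.

(** The generators of the inner ideal do not involve [y], so divisibility by [y ^ a] times such a
    generator splits into a condition on the [y]-degree and one on the other exponents. *)
Lemma inJP v m : uniq (unzip1 v) -> inJ v m = has (fun g => (g <= m)%MM) (gens v).
Proof.
elim: v => //= -[y a] v IH /= /andP[yv /IH ->].
rewrite mulm_y_le has_map.
have gE h : h \in gens v -> (U_(y) *+ a + h <= m)%MM = (a <= m y)%N && (h <= m)%MM.
  move=> hv; have hy : h y = 0%N.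
    apply: (gens_free (V := [:: y])) hv _ _; rewrite ?inE // => z.
    by rewrite inE => /eqP->.
  apply/mnm_lepP/andP => [le|[le /mnm_lepP le'] z].
    split; first by have := le y; rewrite mnmDE mulm_yE hy addn0.
    by apply/mnm_lepP => z; apply: leq_trans (le z); rewrite mnmDE leq_addl.
  rewrite mnmDE; have [->|/mulm_yNE->] := eqVneq z y; last exact: le'.
  by rewrite mulm_yE hy addn0.
case: (ltngtP a (m y)) => //= le.
  by apply/esym/negbTE/hasPn => h /gE /= ->; rewrite leqNgt le.
by apply: eq_in_has => h /gE /= ->; rewrite le leqnn.
Qed.

Lemma genJ_dvd v m : uniq (unzip1 v) -> inJ v m ->
  exists2 l, (l < size v)%N & (genJ v l <= m)%MM.
Proof.
move=> uv; rewrite inJP // => /(hasP)[g gv gm].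
by exists (index g (gens v)); rewrite -?size_gens ?index_mem // /genJ nth_index.
Qed.

End MonomialIdeal.

Section Reduced.
Variables (n : nat) (A : comNzRingType).
Implicit Types (p q : {mpoly A[n]}) (V : seq 'I_n) (y : 'I_n) (v : seq ('I_n * nat)).

Definition reduced v p := supported (fun b => ~~ inJ v b) p.

(** Monomials of [y]-degree above [a] all lie in the ideal, those below [a] never do, and those of
    [y]-degree [a] are decided by the inner ideal. *)
Lemma reduced_cons y a v p : y \notin unzip1 v ->
  reduced ((y, a) :: v) p <-> ydeg_le y a p /\ reduced v (ycoef y a p).
Proof.
move=> yv; split=> [h|[h1 h2] b bp].
  split=> b; first by move/h; rewrite /= negb_or -leqNgt => /andP[].
  rewrite mcoeff_msupp mcoeff_ycoef; case: (b y =P 0%N) => [by0|_]; last by rewrite eqxx.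
  rewrite -mcoeff_msupp => /h /=.
  by rewrite negb_or mnmDE by0 mulm_yE eqxx inJ_shift // => /andP[].
rewrite /= negb_or -leqNgt h1 //=; case: eqP => //= e.
have le : (U_(y) *+ a <= b)%MM by rewrite mulm_y_le e.
rewrite -(submK le) inJ_shift //; apply: h2.
by rewrite mcoeff_msupp mcoeff_ycoef mnmBE mulm_yE e subnn eqxx submK // -mcoeff_msupp.
Qed.

End Reduced.

(** * Standard bases over a ring, and division *)

Section Bases.
Variables (n : nat) (lt : rel 'X_{1..n}) (tl : 'X_{1..n} -> set 'X_{1..n}).
Hypotheses (ltP : term_order lt) (tlP : tail_order lt tl).
Variable (A : comNzRingType).
Implicit Types (p q : {mpoly A[n]}) (V : seq 'I_n) (y : 'I_n) (v : seq ('I_n * nat)).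
Implicit Types (f c : nat -> {mpoly A[n]}).

Definition marked V v f : Prop := forall l, (l < size v)%N ->
  [/\ tmonic tl (genJ v l) (f l), vfree V (f l) &
      reduced v (f l - 'X_[genJ v l])].

(** Together with [division], this says that every polynomial free of [V] is uniquely an element of
    the ideal of the [f l] plus a reduced polynomial: the standard basis property in a form
    meaningful over any commutative ring. *)
Definition standard_basis V v f : Prop :=
  marked V v f /\
  forall c, (forall l, vfree V (c l)) ->
    reduced v (\sum_(l < size v) c l * f l) -> \sum_(l < size v) c l * f l = 0.

Lemma division V v f p : fresh V v -> marked V v f -> vfree V p ->
  exists2 c : nat -> {mpoly A[n]}, (forall l, vfree V (c l)) &
    reduced v (p - \sum_(l < size v) c l * f l).
Proof.
move=> [uv _] hf; pose K p := exists2 c : nat -> {mpoly A[n]}, (forall l, vfree V (c l)) &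
    reduced v (p - \sum_(l < size v) c l * f l).
have K0 : K 0.
  exists (fun=> 0) => [l|]; first exact: supported0.
  by rewrite big1 => [|i _]; rewrite ?mul0r ?subr0 //; exact: supported0.
have KD p1 p2 : K p1 -> K p2 -> K (p1 + p2).
  move=> [c1 h1 r1] [c2 h2 r2]; exists (fun l => c1 l + c2 l) => [l|].
    by apply: supportedD; [exact: h1|exact: h2].
  under eq_bigr do rewrite mulrDl.
  by rewrite big_split opprD addrACA; exact: supportedD.
have KZ (k : A) p1 : K p1 -> K (k *: p1).
  move=> [c1 h1 r1]; exists (fun l => k *: c1 l) => [l|].
    by apply: supportedZ; exact: h1.
  under eq_bigr do rewrite -scalerAl.
  by rewrite -scaler_sumr -scalerBr; exact: supportedZ.
apply: (@supported_ind _ _ (mfree V) K) => // m; elim/(well_founded_ind (term_order_wf ltP)): m.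
move=> m IH mV; have [mJ|mJ] := boolP (inJ v m); last first.
  exists (fun=> 0) => [l|]; first exact: supported0.
  by rewrite big1 => [|i _]; rewrite ?mul0r ?subr0 //; exact: supportedX.
have [l lv /submK gm] := genJ_dvd uv mJ; set d := (m - genJ v l)%MM in gm.
have dV : mfree V d by apply: mfree_le mV; exact: lem_subr.
have [hm hV _] := hf l lv; have [r fE hr] := (tmonic_tl ltP tlP _ _).1 hm.
(* Modulo [f l], the monomial [m] is a combination of smaller monomials, which the induction
   divides. *)
have -> : 'X_[m] = 'X_[d] * f l + (-1 : A) *: ('X_[d] * r).
  by rewrite fE mulrDr -mpolyXD gm scaleN1r addrK.
apply: (KD).
  exists (fun i : nat => if i == l then 'X_[d] else 0) => [i|].
    by case: ifP => _; [exact: supportedX|exact: supported0].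
  rewrite (bigD1 (Ordinal lv)) //= eqxx big1 ?addr0 ?subrr; first exact: supported0.
  by move=> i; rewrite -val_eqE /= => /negPf ->; rewrite mul0r.
apply: (KZ); apply: (@supported_ind _ _ (fun b => lt b m /\ mfree V b)) => //.
  by move=> b [bm bV]; exact: IH.
apply: (@supportedM _ _ (eq d) (fun b => tl (genJ v l) b /\ mfree V b)).
- move=> _ b <- [hb bV]; split; last exact: mfreeD.
  by rewrite -gm (lt_add2l ltP); exact: (tl_lt tlP).
- exact: supportedX.
apply: supportedI => //; have -> : r = f l - 'X_[genJ v l] by rewrite fE addrAC subrr add0r.
apply: supportedB => //; apply: supportedX; apply: mfree_le mV.
by rewrite -gm; exact: lem_addl.
Qed.

Lemma tmonic_ydeg y a p : tmonic tl (U_(y) *+ a)%MM p -> ydeg_le y a p.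
Proof.
move=> [_ h]; apply: supportedW h => b [->|/(tl_lt tlP)/(lt_ydeg ltP)/ltnW//].
by rewrite mulm_yE.
Qed.

Lemma tmonic_ycoef y a p : tmonic tl (U_(y) *+ a)%MM p -> ycoef y a p = 1.
Proof.
move=> /(tmonic_tl ltP tlP)[r -> hr]; rewrite raddfD /= ycoefX mulm_yE eqxx.
rewrite -[X in (X - _)%MM]add0m addmK mpolyX0 ycoef_lt ?addr0 //.
by apply: supportedW hr => b /(tl_lt tlP)/(lt_ydeg ltP).
Qed.

Lemma tmonic_ycoefM y a V p q : tmonic tl (U_(y) *+ a)%MM p -> vfree (y :: V) q ->
  ycoef y a (p * q) = q.
Proof. by move=> hp hq; rewrite mulrC (ycoefMl _ _ hq) tmonic_ycoef // mulr1. Qed.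

(** The leading term of a product with non-zero [q] would have [y]-degree at least [a + 1]. This is
    the uniqueness of division by a polynomial monic in [y]. *)
Lemma tmonic_mul_ydeg y a p q : tmonic tl (U_(y) *+ a.+1)%MM p ->
  ydeg_le y a (p * q) -> q = 0.
Proof.
move=> hp h; apply/eqP; apply: contraT => /(tmonicM_lead ltP tlP hp)[m mq e].
have : (U_(y) *+ a.+1 + m)%MM \in msupp (p * q) by rewrite mcoeff_msupp e -mcoeff_msupp.
by move/h; rewrite mnmDE mulm_yE addSn ltnNge leq_addr.
Qed.

(** Euclidean division by [y - t], with remainder the value at [y = t]; for monomials, by induction
    on the [y]-degree from [y * m = (y - t) * m + t * m]. *)
Lemma vfree_divX y V t p : y \notin V -> vfree (y :: V) t -> vfree V p ->
  exists q r, [/\ p = ('X_y - t) * q + r, vfree V q & vfree (y :: V) r].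
Proof.
move=> yV ht; have tV := vfree_consW ht.
have yfree : vfree V ('X_y : {mpoly A[n]}).
  by apply: supportedX => z zV; rewrite mnm1E; case: eqP => // e; rewrite e zV in yV.
apply: (@supported_ind _ _ _ (fun p => exists q r,
  [/\ p = ('X_y - t) * q + r, vfree V q & vfree (y :: V) r])).
- by exists 0, 0; split; rewrite ?mulr0 ?addr0 //; exact: supported0.
- move=> _ _ [q1 [r1 [-> h1 k1]]] [q2 [r2 [-> h2 k2]]].
  exists (q1 + q2), (r1 + r2); split; rewrite ?mulrDr; first exact: addrACA.
    exact: supportedD.
  exact: supportedD.
- move=> c _ [q1 [r1 [-> h1 k1]]]; exists (c *: q1), (c *: r1).
  by split; rewrite ?scalerDr -?scalerAr //; exact: supportedZ.
move=> m mV; move: {2}(m y) (erefl (m y)) => k; elim: k => [|k IH] in m mV * => my.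
  exists 0, 'X_[m]; rewrite mulr0 add0r; split=> //; first exact: supported0.
  by apply: supportedX; exact: mfree_cons.
have le : (U_(y) <= m)%MM by rewrite lep1mP my.
have [||q [r [e hq hr]]] := IH (m - U_(y))%MM.
- by apply: mfree_le mV; exact: lem_subr.
- by rewrite mnmBE my mnm1E eqxx subn1.
exists ('X_[m - U_(y)] + t * q), (t * r); split.
- rewrite -[in LHS](submK le) mpolyXD {1}e; ring: e.
- apply: supportedD; last exact: vfreeM.
  by apply: supportedX; apply: mfree_le mV; exact: lem_subr.
- exact: vfreeM.
Qed.

End Bases.

(** * Products of monic and linear factors *)

Section Family.
Variables (n : nat) (lt : rel 'X_{1..n}) (tl : 'X_{1..n} -> set 'X_{1..n}).
Hypotheses (ltP : term_order lt) (tlP : tail_order lt tl).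
Implicit Types (V : seq 'I_n) (y : 'I_n) (v : seq ('I_n * nat)) (m b g : 'X_{1..n}).

Definition tailset V y a : {fset 'X_{1..n}} :=
  fset_set [set b | tl (U_(y) *+ a)%MM b /\ mfree V b]%classic.

Definition lintail V y v : {fset 'X_{1..n}} :=
  fset_set [set b | [/\ tl U_(y)%MM b, mfree (y :: V) b & ~~ inJ v b]]%classic.

(* The coordinates of level [y]: the coefficients of the monic factor with
   leading monomial [y ^ a] carry [false], those determining the linear factor
   carry [true]. *)
Definition param : Type := 'I_n * bool * 'X_{1..n}.

(** At the last level the ideal is principal with generator [y ^ (a + 1)], so a single monic
    polynomial is the only datum. *)
Fixpoint params V v : seq param :=
  if v is (y, a) :: v' then
    if nilp v' then [seq (y, false, b) | b <- tailset V y a.+1]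
    else [seq (y, false, b) | b <- tailset V y a]
      ++ [seq (y, true, b) | b <- lintail V y v'] ++ params (y :: V) v'
  else [::].

Lemma tailsetP V y a b : reflect (tl (U_(y) *+ a)%MM b /\ mfree V b) (b \in tailset V y a).
Proof.
rewrite /tailset in_fset_set; first by apply: (iffP idP) => [/set_mem|/mem_set].
by apply: (sub_finite_set _ (tl_fin tlP (U_(y) *+ a)%MM)) => c [].
Qed.

Lemma lintailP V y v b : reflect [/\ tl U_(y)%MM b, mfree (y :: V) b & ~~ inJ v b]
  (b \in lintail V y v).
Proof.
rewrite /lintail in_fset_set; first by apply: (iffP idP) => [/set_mem|/mem_set].
by apply: (sub_finite_set _ (tl_fin tlP U_(y)%MM)) => c [].
Qed.

Section OverRing.
Variable A : comNzRingType.
Implicit Types (d : param -> A) (p q : {mpoly A[n]}).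

Lemma supported_fset (s : {fset 'X_{1..n}}) (e : 'X_{1..n} -> A) :
  supported (fun b => b \in s) (\sum_(b <- s) e b *: 'X_[b]).
Proof.
by apply: supported_sum => b bs; apply: supportedZ; apply: supportedX.
Qed.

Lemma mcoeff_fset (s : {fset 'X_{1..n}}) (e : 'X_{1..n} -> A) m :
  m \in s -> (\sum_(b <- s) e b *: 'X_[b])@_m = e m.
Proof.
move=> ms; rewrite raddf_sum /= (bigD1_seq m) ?fset_uniq //= big1_seq ?addr0.
  by rewrite mcoeffZ mcoeffX eqxx mulr1.
by move=> b /andP[ne _]; rewrite mcoeffZ mcoeffX (negPf ne) mulr0.
Qed.

Lemma mpoly_fset (s : {fset 'X_{1..n}}) p : supported (fun b => b \in s) p ->
  p = \sum_(b <- s) p@_b *: 'X_[b].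
Proof.
move=> hp; apply/mpolyP => m; have [ms|ms] := boolP (m \in s).
  by rewrite mcoeff_fset.
rewrite (supported_coef0 hp (negP ms)).
by rewrite (supported_coef0 (@supported_fset _ _) (negP ms)).
Qed.

Definition powpoly V y a d : {mpoly A[n]} :=
  'X_[U_(y) *+ a] + \sum_(b <- tailset V y a) d (y, false, b) *: 'X_[b].

Definition linpoly V y v d : {mpoly A[n]} :=
  \sum_(b <- lintail V y v) d (y, true, b) *: 'X_[b].

(* The linear factor is parametrised by the coefficient of [y ^ a] in the
   product, which makes the product reduced without any further correction. *)
Definition linfactor V y a v d : {mpoly A[n]} :=
  'X_y - (ycoef y a ('X_y * powpoly V y a d) - linpoly V y v d).

(** The generators of [F ((L) + I')] in the order of [gens]: first [F * L], then [F] times the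
    generators of the inner family. *)
Fixpoint prodfam V v d (l : nat) : {mpoly A[n]} :=
  if v is (y, a) :: v' then
    if nilp v' then powpoly V y a.+1 d
    else if l is l'.+1 then powpoly V y a d * prodfam (y :: V) v' d l'
    else powpoly V y a d * linfactor V y a v' d
  else 0.

Lemma powpoly_tmonic V y a d : tmonic tl (U_(y) *+ a)%MM (powpoly V y a d).
Proof.
apply/(tmonic_tl ltP tlP); eexists; first by [].
by apply: supportedW (@supported_fset _ _) => b /tailsetP[].
Qed.

Lemma powpoly_vfree V y a d : y \notin V -> vfree V (powpoly V y a d).
Proof.
move=> yV; apply: supportedD; first by apply: supportedX; exact: mfree_mulm.
by apply: supportedW (@supported_fset _ _) => b /tailsetP[].
Qed.

Lemma mulm1_y y : U_(y)%MM = (U_(y) *+ 1)%MM :> 'X_{1..n}.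
Proof. by rewrite mulm1n. Qed.

Lemma vfreeX V y : y \notin V -> vfree V ('X_y : {mpoly A[n]}).
Proof. by move=> yV; apply: supportedX; rewrite mulm1_y; exact: mfree_mulm. Qed.

Lemma ycoef_tl y a g p : supported (tl (g + U_(y) *+ a)%MM) p ->
  supported (tl g) (ycoef y a p).
Proof.
move=> hp b; rewrite mcoeff_msupp mcoeff_ycoef; case: ifP; last by rewrite eqxx.
by rewrite -mcoeff_msupp => _ /hp /(tl_add tlP).
Qed.

Lemma ycoef_tmonic y a g p : g y = 0%N -> tmonic tl (U_(y) *+ a + g)%MM p ->
  tmonic tl g (ycoef y a p).
Proof.
move=> gy [h1 h2]; split; first by rewrite mcoeff_ycoef gy eqxx addmC.
move=> b; rewrite mcoeff_msupp mcoeff_ycoef; case: ifP; last by rewrite eqxx.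
rewrite -mcoeff_msupp addmC => _ /h2[/addmI->|/(tl_addl tlP)]; by [left|right].
Qed.

Lemma linfactor_tmonic V y a v d : tmonic tl U_(y)%MM (linfactor V y a v d).
Proof.
apply/(tmonic_tl ltP tlP); eexists; first by [].
apply: supportedN; apply: supportedB; last first.
  by apply: supportedW (@supported_fset _ _) => b /lintailP[].
have /(tmonic_tl ltP tlP)[r -> hr] := powpoly_tmonic V y a d.
(* The leading term of [y * F] has [y]-degree [a + 1] and drops out; the other terms lie in the tail
   of [y ^ (a + 1)], and dividing by [y ^ a] brings them into the tail of [y]. *)
rewrite mulrDr raddfD /= -mpolyXD ycoefX mnmDE mulm_yE mnm1E eqxx.
rewrite gtn_eqF // add0r; apply: ycoef_tl.
apply: supportedM (@supportedX _ _ (eq U_(y)%MM) _ erefl) hr => _ b <- hb.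
exact/(tl_addl tlP).
Qed.

Lemma linfactor_tail_vfree V y a v d : y \notin V ->
  vfree (y :: V) (ycoef y a ('X_y * powpoly V y a d) - linpoly V y v d).
Proof.
move=> yV; apply: supportedB.
  by apply: ycoef_free; apply: vfreeM; [exact: vfreeX|exact: powpoly_vfree].
by apply: supportedW (@supported_fset _ _) => b /lintailP[].
Qed.

Lemma linfactor_vfree V y a v d : y \notin V -> vfree V (linfactor V y a v d).
Proof.
move=> yV; apply: supportedB; first exact: vfreeX.
exact/vfree_consW/linfactor_tail_vfree.
Qed.

(** The subtracted part of [linfactor] is free of [y] and [F] has coefficient 1 at [y ^ a], so the
    coefficient of [y ^ a] in [y * F] cancels and only [linpoly] remains. *)
Lemma ycoef_linfactor V y a v d : y \notin V ->
  ycoef y a (powpoly V y a d * linfactor V y a v d) = linpoly V y v d.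
Proof.
move=> yV; rewrite /linfactor mulrBr raddfB /= (tmonic_ycoefM ltP tlP (powpoly_tmonic _ _ _ _)
  (@linfactor_tail_vfree V y a v d yV)).
by rewrite mulrC opprB addrC subrK.
Qed.

Lemma powpolyM_lin V y a v d :
  tmonic tl (U_(y) *+ a.+1)%MM (powpoly V y a d * linfactor V y a v d).
Proof.
rewrite mulmSr; apply: (tmonicM ltP tlP); first exact: powpoly_tmonic.
exact: linfactor_tmonic.
Qed.

Lemma tmonicB_ydeg y a p : tmonic tl (U_(y) *+ a.+1)%MM p ->
  ydeg_le y a (p - 'X_[U_(y) *+ a.+1]).
Proof.
move=> /(tmonic_tl ltP tlP)[r -> hr]; rewrite addrAC subrr add0r.
by apply: supportedW hr => b /(tl_lt tlP)/(lt_ydeg ltP).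
Qed.

(** By [reduced_cons] only the coefficient of [y ^ a] matters. It is [linpoly] in the first
    generator, reduced by the choice of [lintail], and the inner generator in each of the others. *)
Lemma prodfam_marked V v d : fresh V v -> marked tl V v (prodfam V v d).
Proof.
elim: v V => // -[y a] v IH V /fresh_cons[fv yV yv] l lv /=.
case: nilP => [vE|/eqP vN].
  move: lv; rewrite vE; case: l => // _; split; first exact: powpoly_tmonic.
    exact: powpoly_vfree.
  apply/reduced_cons => //; split; last by move=> b.
  exact/tmonicB_ydeg/powpoly_tmonic.
case: l lv => [_|l]; last rewrite ltnS => lv.
  split; first exact: powpolyM_lin.
    by apply: vfreeM; [exact: powpoly_vfree|exact: linfactor_vfree].
  apply/reduced_cons => //; split; first exact/tmonicB_ydeg/powpolyM_lin.
  rewrite raddfB /= ycoef_linfactor // ycoefX mulm_yE gtn_eqF // subr0.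
  by apply: supportedW (@supported_fset _ _) => b /lintailP[].
have [h1 h2 h3] := IH _ fv l lv; rewrite genJS //; split.
- by apply: (tmonicM ltP tlP) => //; exact: powpoly_tmonic.
- by apply: vfreeM; [exact: powpoly_vfree|exact: vfree_consW h2].
have gf := genJ_free fv lv.
have yg : genJ v l y = 0%N by exact: mfree_head gf.
apply/reduced_cons => //; split.
  apply: supportedB.
    exact: (ydeg_leMr (tmonic_ydeg ltP tlP (powpoly_tmonic _ _ _ _)) h2).
  by apply: supportedX; rewrite mnmDE mulm_yE yg addn0.
rewrite raddfB /= (tmonic_ycoefM ltP tlP (powpoly_tmonic _ _ _ _) h2).
by rewrite ycoefX mnmDE mulm_yE yg addn0 eqxx addmC addmK.
Qed.

(** Dividing the coefficients by [y - t] brings a combination to the form [F * L * u + F * w], with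
    [w] a combination of the inner family free of [y]. If it is reduced, its [y]-degree forces
    [u = 0]; its coefficient of [y ^ a] is then [w], which vanishes by induction. *)
Lemma prodfam_independent V v d (c : nat -> {mpoly A[n]}) : fresh V v -> (forall l, vfree V (c l)) ->
  reduced v (\sum_(l < size v) c l * prodfam V v d l) ->
  \sum_(l < size v) c l * prodfam V v d l = 0.
Proof.
elim: v V c => [|[y a] v IH] V c; first by rewrite big_ord0.
move=> /fresh_cons[fv yV yv] hc; have [vE|/eqP vN] := v =P [::].
  rewrite vE /= big_ord1 /= => /reduced_cons[] // h _.
  rewrite mulrC in h *.
  by rewrite (tmonic_mul_ydeg ltP tlP (powpoly_tmonic _ _ _ _) h) mulr0.
rewrite /= (introF nilP (elimN eqP vN)) big_ord_recl /=.
set F := powpoly V y a d; set t := ycoef y a ('X_y * F) - linpoly V y v d.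
have tf : vfree (y :: V) t by exact: linfactor_tail_vfree.
have /choice[qr hqr] l : exists x : {mpoly A[n]} * {mpoly A[n]},
    [/\ c l.+1 = ('X_y - t) * x.1 + x.2, vfree V x.1 & vfree (y :: V) x.2].
  by have [q [r ?]] := vfree_divX yV tf (hc l.+1); exists (q, r).
pose u := c 0%N + \sum_(l < size v) (qr l).1 * prodfam (y :: V) v d l.
pose w := \sum_(l < size v) (qr l).2 * prodfam (y :: V) v d l.
have wf : vfree (y :: V) w.
  apply: supported_sum => l _; apply: vfreeM; first by have [] := hqr l.
  by have [] := prodfam_marked d fv (ltn_ord l).
have -> : c 0%N * (F * linfactor V y a v d) +
    \sum_(i < size v) c i.+1 * (F * prodfam (y :: V) v d i) =
    F * linfactor V y a v d * u + F * w.
  rewrite /u /w (mulrDr _ (c 0%N)) -addrA [X in _ = X + _]mulrC; congr (_ + _).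
  rewrite !mulr_sumr -big_split /=; apply: eq_bigr => l _.
  have [-> _ _] := hqr l; rewrite /linfactor -/F -/t; ring.
have Fw : ydeg_le y a (F * w).
  exact: (ydeg_leMr (tmonic_ydeg ltP tlP (powpoly_tmonic _ _ _ _)) wf).
move=> red; have [h1 h2] := (reduced_cons a _ yv).1 red.
have u0 : u = 0.
  apply: (tmonic_mul_ydeg ltP tlP (powpolyM_lin V y a v d)).
  rewrite -[X in ydeg_le _ _ X](addrK (F * w)); exact: supportedB.
move: h2; rewrite u0 mulr0 add0r (tmonic_ycoefM ltP tlP (powpoly_tmonic _ _ _ _) wf).
rewrite /w => h2; rewrite (IH _ (fun l => (qr l).2) fv _ h2) ?mulr0 // => l.
by have [] := hqr l.
Qed.

Lemma prodfam_standard V v d : fresh V v -> standard_basis tl V v (prodfam V v d).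
Proof.
move=> fv; split; first exact: prodfam_marked.
by move=> c; exact: prodfam_independent.
Qed.

Lemma powpoly_inj V y a d d' : powpoly V y a d = powpoly V y a d' ->
  forall b, b \in tailset V y a -> d (y, false, b) = d' (y, false, b).
Proof.
move=> /addrI e b bs; have := congr1 (mcoeff b) e.
by rewrite (mcoeff_fset (fun b => d (y, false, b))) // (mcoeff_fset (fun b => d' (y, false, b))).
Qed.

(** The factors can be read off: the inner family as coefficients of [y ^ a], then [F] by cancelling
    a monic inner generator, then [linpoly] as the coefficient of [y ^ a] in the first generator. *)
Lemma prodfam_inj V v d d' : fresh V v ->
  (forall l, (l < size v)%N -> prodfam V v d l = prodfam V v d' l) ->
  {in params V v, d =1 d'}.
Proof.
elim: v V => // -[y a] v IH V /fresh_cons[fv yV yv] /=; case: nilP => [vE|vN] h k.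
  by move=> /mapP[b bs ->]; apply: powpoly_inj (h 0%N _) b bs.
have fE l : (l < size v)%N -> prodfam (y :: V) v d l = prodfam (y :: V) v d' l.
  move=> lv; have := congr1 (ycoef y a) (h l.+1 lv).
  have [_ h1 _] := prodfam_marked d fv lv; have [_ h2 _] := prodfam_marked d' fv lv.
  by rewrite !(tmonic_ycoefM ltP tlP (powpoly_tmonic _ _ _ _) (V := V)).
have v0 : (0 < size v)%N by case: (v) vN.
rewrite !mem_cat => /or3P[/mapP[b bs ->]|/mapP[b bs ->]|].
- apply: powpoly_inj bs; have := h 1%N v0; rewrite -fE //.
  have [hm _ _] := prodfam_marked d fv v0.
  by rewrite ![_ * prodfam _ _ _ _]mulrC; exact: (tmonic_cancel ltP tlP hm).
- have := congr1 (mcoeff b \o ycoef y a) (h 0%N isT).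
  rewrite /= !ycoef_linfactor // (mcoeff_fset (fun b => d (y, true, b))) //.
  by rewrite (mcoeff_fset (fun b => d' (y, true, b))).
exact: IH.
Qed.

(** Coordinates of different levels carry different variables, so those of one level can be changed
    without touching the inner ones. *)
Lemma params_var V v k : k \in params V v -> k.1.1 \in unzip1 v.
Proof.
elim: v V => // -[y a] v IH V /=; case: nilP => [_ /mapP[b _ ->]|_]; first exact: mem_head.
rewrite !mem_cat => /or3P[/mapP[b _ ->]|/mapP[b _ ->]|/IH h]; try exact: mem_head.
by rewrite inE h orbT.
Qed.

Lemma prodfam_ext V v d d' l : {in params V v, d =1 d'} ->
  prodfam V v d l = prodfam V v d' l.
Proof.
have pE y a W : {in [seq (y, false, b) | b <- tailset W y a], d =1 d'} ->
    powpoly W y a d = powpoly W y a d'.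
  by move=> h; congr (_ + _); apply: eq_big_seq => b bs; rewrite h // map_f.
elim: v V l => // -[y a] v IH V l /=; case: nilP => [_ h|_ h]; first exact: pE.
have hF : powpoly V y a d = powpoly V y a d'.
  by apply: pE => k ks; apply: h; rewrite mem_cat ks.
case: l => [|l]; last first.
  by rewrite hF (IH _ l) // => k ks; apply: h; rewrite !mem_cat ks !orbT.
rewrite /linfactor hF; congr (_ * (_ - (_ - _))); apply: eq_big_seq => b bs.
by rewrite h // !mem_cat map_f ?orbT.
Qed.

End OverRing.

Lemma map_ycoef (A B : comNzRingType) (phi : {rmorphism A -> B}) y a (p : {mpoly A[n]}) :
  map_mpoly phi (ycoef y a p) = ycoef y a (map_mpoly phi p).
Proof.
apply/mpolyP => m; rewrite mcoeff_map_mpoly !mcoeff_ycoef mcoeff_map_mpoly.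
by case: ifP => _ //; exact: rmorph0.
Qed.

Lemma map_prodfam (A B : comNzRingType) (phi : {rmorphism A -> B}) V v d l :
  map_mpoly phi (prodfam V v d l) = prodfam V v (phi \o d) l.
Proof.
elim: v V l => [|[y a] v IH] V l /=; first exact: rmorph0.
have sE (s : {fset 'X_{1..n}}) e : map_mpoly phi (\sum_(b <- s) e b *: 'X_[b]) =
    \sum_(b <- s) phi (e b) *: 'X_[b].
  by rewrite rmorph_sum; apply: eq_bigr => b _ /=; rewrite map_mpolyZ map_mpolyX.
have pE k : map_mpoly phi (powpoly V y k d) = powpoly V y k (phi \o d).
  by rewrite rmorphD /= map_mpolyX sE.
case: nilP => // _; case: l => [|l]; rewrite rmorphM /= pE; congr (_ * _); last exact: IH.
by rewrite /linfactor !rmorphB /= map_ycoef rmorphM /= pE !map_mpolyX sE.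
Qed.

End Family.

(** * Factorization of standard bases *)

Section Factorization.
Variables (n : nat) (lt : rel 'X_{1..n}) (tl : 'X_{1..n} -> set 'X_{1..n}).
Hypotheses (ltP : term_order lt) (tlP : tail_order lt tl).
Variable (A : comNzRingType).
Implicit Types (V : seq 'I_n) (y : 'I_n) (v : seq ('I_n * nat)) (m b g : 'X_{1..n}).
Implicit Types (p q : {mpoly A[n]}) (f : nat -> {mpoly A[n]}).

Lemma powpoly_surj V y a F (d : param n -> A) : y \notin V ->
  tmonic tl (U_(y) *+ a)%MM F -> vfree V F ->
  (forall b, d (y, false, b) = F@_b) -> F = powpoly tl V y a d.
Proof.
move=> yV hF FV hd; have [r FE hr] := (tmonic_tl ltP tlP _ _).1 hF.
have rE : r = F - 'X_[U_(y) *+ a] by rewrite FE addrAC subrr add0r.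
have rs : supported (fun b => b \in tailset tl V y a) r.
  move=> b br; apply/(tailsetP tlP); split; first exact: hr.
  suff: vfree V r by apply.
  by rewrite rE; apply: supportedB => //; apply: supportedX; exact: mfree_mulm.
rewrite {1}FE /powpoly {1}(mpoly_fset rs); congr (_ + _).
apply: eq_big_seq => b /(tailsetP tlP)[bt _]; rewrite hd FE mcoeffD mcoeffX.
case: eqP => [e|_]; last by rewrite add0r.
by case: (tl_irr ltP tlP (a := b)); rewrite -{1}e.
Qed.

Lemma linpoly_surj V y v E (d : param n -> A) :
  supported (tl U_(y)%MM) E -> vfree (y :: V) E -> reduced v E ->
  (forall b, d (y, true, b) = E@_b) -> E = linpoly tl V y v d.
Proof.
move=> h1 h2 h3 hd; under [RHS]eq_bigr do rewrite hd; apply: mpoly_fset => b bE.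
by apply/(lintailP tlP); split; [exact: h1|exact: h2|exact: h3].
Qed.

Section Step.
Variables (V : seq 'I_n) (y : 'I_n) (a : nat) (v : seq ('I_n * nat)).
Variable (f : nat -> {mpoly A[n]}).
Hypotheses (fr : fresh V ((y, a) :: v)) (hf : standard_basis tl V ((y, a) :: v) f).

Let p l := ycoef y a (f l.+1).

Lemma marked_ydeg l : (l < size v)%N -> ydeg_le y a (f l.+1).
Proof.
have [fv yV yv] := fresh_cons fr => lv; have [_ _] := hf.1 l.+1 lv.
move/(reduced_cons a _ yv) => [h _]; rewrite -[f _](subrK 'X_[genJ ((y, a) :: v) l.+1]).
apply: supportedD => //; apply: supportedX; rewrite genJS // mnmDE mulm_yE.
by rewrite (mfree_head (genJ_free fv lv)) addn0.
Qed.

Lemma ycoef_marked : marked tl (y :: V) v p.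
Proof.
have [fv yV yv] := fresh_cons fr => l lv; have [h1 h2 h3] := hf.1 l.+1 lv.
have yg := mfree_head (genJ_free fv lv).
split; first by apply: (ycoef_tmonic tlP) => //; rewrite -genJS.
  exact: ycoef_free.
move/(reduced_cons a _ yv): h3 => [_]; rewrite raddfB /= ycoefX genJS //.
by rewrite mnmDE mulm_yE yg addn0 eqxx [(_ + genJ _ _)%MM]addmC addmK.
Qed.

Lemma comb_ydeg (c : nat -> {mpoly A[n]}) : (forall l, vfree (y :: V) (c l)) ->
  ydeg_le y a (\sum_(l < size v) c l * f l.+1).
Proof.
move=> hc; apply: supported_sum => l _; rewrite mulrC.
exact: (ydeg_leMr (marked_ydeg (ltn_ord l)) (hc l)).
Qed.

Lemma ycoef_comb (c : nat -> {mpoly A[n]}) : (forall l, vfree (y :: V) (c l)) ->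
  ycoef y a (\sum_(l < size v) c l * f l.+1) = \sum_(l < size v) c l * p l.
Proof.
by move=> hc; rewrite raddf_sum; apply: eq_bigr => l _; exact: (ycoefMl _ _ (hc l)).
Qed.

(** Such combinations have [y]-degree at most [a], so being reduced is seen on the coefficient of
    [y ^ a]. In particular relations among the [p l] with coefficients free of [y] lift to the
    [f l.+1]. *)
Lemma comb_eq0 (c : nat -> {mpoly A[n]}) : (forall l, vfree (y :: V) (c l)) ->
  reduced v (\sum_(l < size v) c l * p l) ->
  \sum_(l < size v) c l * f l.+1 = 0.
Proof.
have [fv yV yv] := fresh_cons fr => hc red.
have := hf.2 (fun l => if l is l'.+1 then c l' else 0).
rewrite /= big_ord_recl /= mul0r add0r; apply.
  by case=> [|l]; [exact: supported0|exact: vfree_consW (hc l)].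
apply/(reduced_cons a _ yv); split; first exact: comb_ydeg.
by rewrite ycoef_comb.
Qed.

Lemma ycoef_standard : standard_basis tl (y :: V) v p.
Proof.
split=> [|c hc red]; first exact: ycoef_marked.
by rewrite -ycoef_comb // comb_eq0 ?raddf0.
Qed.

Lemma sum_delta k (e : {mpoly A[n]}) (g : nat -> {mpoly A[n]}) : (k < size v)%N ->
  \sum_(l < size v) (if l == k :> nat then e else 0) * g l = e * g k.
Proof.
move=> kv; rewrite (bigD1 (Ordinal kv)) //= eqxx big1 ?addr0 // => i.
by rewrite -val_eqE /= => /negPf->; rewrite mul0r.
Qed.

Lemma ycoef_vfree l : (l < size v)%N -> vfree (y :: V) (p l).
Proof. by move=> lv; have [] := ycoef_marked lv. Qed.

Lemma vfree_if k (e : {mpoly A[n]}) W (l : nat) : vfree W e ->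
  vfree W (if l == k then e else 0).
Proof. by case: ifP => // _ _; exact: supported0. Qed.

Lemma ycoef_cross k l : (k < size v)%N -> (l < size v)%N ->
  p k * f l.+1 = p l * f k.+1.
Proof.
move=> kv lv; apply/eqP; rewrite -subr_eq0; apply/eqP.
pose c (i : nat) := (if i == l then p k else 0) - (if i == k then p l else 0).
have cE (g : nat -> {mpoly A[n]}) : \sum_(i < size v) c i * g i = p k * g l - p l * g k.
  under eq_bigr do rewrite mulrBl.
  by rewrite sumrB !sum_delta.
rewrite -(cE (fun i => f i.+1)) comb_eq0 // => [i|].
  by apply: supportedB; apply: vfree_if; exact: ycoef_vfree.
by rewrite cE mulrC subrr; exact: supported0.
Qed.

Let w l := 'X_y * f l.+1 - p l * f 0.

Lemma spair_comb l : (l < size v)%N -> exists2 c : nat -> {mpoly A[n]},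
  (forall k, vfree (y :: V) (c k)) & w l = \sum_(k < size v) c k * f k.+1.
Proof.
have [fv yV yv] := fresh_cons fr => lv.
have [m0 v0 _] := hf.1 0%N isT; have [ml vl _] := hf.1 l.+1 lv.
have wa1 : ydeg_le y a.+1 (w l).
  apply: supportedB.
    apply: (@supportedM _ _ (fun b => b y <= 1)%N (fun b => b y <= a)%N).
    - by move=> b c hb hc; rewrite mnmDE -add1n leq_add.
    - by apply: supportedX; rewrite mnm1E eqxx.
    - exact: marked_ydeg.
  rewrite mulrC; exact: (ydeg_leMr (tmonic_ydeg ltP tlP m0) (ycoef_vfree lv)).
(* Both terms of [w l] have the coefficient [p l] at [y ^ (a + 1)]. *)
have wa : ydeg_le y a (w l).
  apply: ydeg_le_pred wa1 _; rewrite raddfB /= [p l * _]mulrC.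
  rewrite (tmonic_ycoefM ltP tlP m0 (ycoef_vfree lv)).
  apply/eqP; rewrite subr_eq0; apply/eqP/mpolyP => m; rewrite /p !mcoeff_ycoef.
  by case: ifP => // _; rewrite mulmSr addmA ['X_y * _]mulrC [X in mcoeff X _ = _]addmC mcoeffMX.
have wV : vfree V (w l).
  apply: supportedB; apply: vfreeM => //; first exact: vfreeX.
  exact/vfree_consW/ycoef_vfree.
(* Dividing the coefficient of [y ^ a] in [w l] by the [p k] and subtracting the same combination of
   the [f k.+1] leaves a reduced element of the ideal, hence zero. *)
have [c hc red] := division ltP tlP fv ycoef_marked (@ycoef_free _ _ y a _ _ wV).
exists c => //; apply/eqP; rewrite -subr_eq0; apply/eqP.
pose e (k : nat) := if k is k'.+1 then ('X_y *+ (k' == l) - c k') else - p l.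
have eE : w l - \sum_(k < size v) c k * f k.+1 =
    \sum_(k < size ((y, a) :: v)) e k * f k.
  have sE : \sum_(k < size v) e k.+1 * f k.+1 =
      'X_y * f l.+1 - \sum_(k < size v) c k * f k.+1.
    rewrite -(sum_delta 'X_y (fun i => f i.+1) lv) -sumrB; apply: eq_bigr => i _.
    by rewrite /e mulrBl; case: eqP => _; rewrite ?mulr1n ?mulr0n.
  by rewrite /= big_ord_recl [X in _ = _ + X]sE /w /e /=; ring.
rewrite eE; apply: (hf.2 e) => [[|k]|] /=.
- by apply: supportedN; exact: vfree_consW (ycoef_vfree lv).
- apply: supportedB; last exact: vfree_consW (hc k).
  by case: eqP => _; [exact: vfreeX|exact: supported0].
rewrite -[X in reduced _ X]eE.
apply/(reduced_cons a _ yv); split; first exact: supportedB wa (comb_ydeg hc).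
by rewrite raddfB /= ycoef_comb.
Qed.

(* Up to a common monic factor, [p 0] is a polynomial [L] linear in [z] and the
   other [p l] do not involve [z], so a relation [L * u1 = r1 * u0] forces [L] to
   divide [u0]; the quotient is [t]. *)
Lemma spair_multiplier (d : param n -> A) : (0 < size v)%N ->
  (forall l, (l < size v)%N -> p l = prodfam tl (y :: V) v d l) ->
  exists2 t, vfree (y :: V) t & forall l, (l < size v)%N -> w l = t * f l.+1.
Proof.
have [fv yV yv] := fresh_cons fr => v0 pE.
have /choice[c hc] l : exists c : nat -> {mpoly A[n]}, (l < size v)%N ->
    (forall k, vfree (y :: V) (c k)) /\ w l = \sum_(k < size v) c k * f k.+1.
  have [lv|_] := boolP (l < size v)%N; last by exists (fun=> 0).
  by have [c h1 h2] := spair_comb lv; exists c.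
have sE l : (l < size v)%N -> ycoef y a (w l) = \sum_(k < size v) c l k * p k.
  by move=> lv; have [h ->] := hc l lv; rewrite ycoef_comb.
have [zb [v' vE]] : exists zb v', v = zb :: v' by case: (v) v0 => // zb v'; exists zb, v'.
case: zb vE => z b vE; have [v'E|/eqP v'N] := v' =P [::].
  (* If the inner ideal is principal, [w 0] is already a multiple of [f 1]. *)
  have [cV w0] := hc 0%N v0; exists (c 0%N 0%N); first exact: cV.
  move=> l; rewrite {1}vE v'E; case: l => // _; rewrite w0.
  by rewrite vE v'E big_ord1.
have [fv' zV zv'] : [/\ fresh (z :: y :: V) v', z \notin y :: V & z \notin unzip1 v'].
  by apply: (@fresh_cons _ _ _ b); rewrite -vE.
have v'0 : (0 < size v')%N by case: (v') v'N.
pose F := powpoly tl (y :: V) z b d; pose L := linfactor tl (y :: V) z b v' d.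
pose r (l : nat) := if l is l'.+1 then prodfam tl (z :: y :: V) v' d l' else L.
have prE l : (l < size v)%N -> p l = F * r l.
  move=> lv; rewrite pE // vE /= (introF nilP (elimN eqP v'N)).
  by case: l lv.
have hF : tmonic tl (U_(z) *+ b)%MM F by exact: (powpoly_tmonic ltP tlP).
have hL : tmonic tl (U_(z) *+ 1)%MM L by rewrite -mulm1_y; exact: (linfactor_tmonic ltP tlP).
pose u l := \sum_(k < size v) c l k * r k.
have suE l : (l < size v)%N -> ycoef y a (w l) = F * u l.
  move=> lv; rewrite sE // mulr_sumr; apply: eq_bigr => k _.
  by rewrite prE // mulrCA.
have lin : tmonic tl (genJ v 0) (p 0%N) by have [] := ycoef_marked v0.
(* The relations [p k * f l.+1 = p l * f k.+1] give [p k * w l = p l * w k]; the factor [F] is then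
   cancelled twice from the coefficients of [y ^ a]. *)
have cross l k : (l < size v)%N -> (k < size v)%N -> r k * u l = r l * u k.
  move=> lv kv.
  have e : p k * w l = p l * w k.
    by rewrite /w !mulrBr !mulrA ![p _ * 'X_y]mulrC -!mulrA (ycoef_cross kv lv)
      [p k * (p l * _)]mulrCA.
  have := congr1 (ycoef y a) e.
  rewrite !(ycoefMl _ _ (ycoef_vfree _)) // !suE // !prE // -!mulrA.
  move/(tmonic_cancel ltP tlP hF); rewrite ![r _ * (F * _)]mulrCA.
  exact: (tmonic_cancel ltP tlP hF).
have rV l : (l < size v)%N -> vfree (y :: V) (r l).
  rewrite vE; case: l => [_|l lv]; first exact: (linfactor_vfree tlP).
  by have [_ /vfree_consW] := prodfam_marked ltP tlP d fv' lv.
have uV l : (l < size v)%N -> vfree (y :: V) (u l).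
  move=> lv; apply: supported_sum => k _; apply: vfreeM; last exact: rV.
  by have [] := hc l lv.
have v1 : (1 < size v)%N by rewrite vE.
have [t [rho [u0E tV rhoV]]] :=
  vfree_divX zV (@linfactor_tail_vfree _ _ _ tlP A (y :: V) z b v' d zV) (uV _ v0).
rewrite -/(linfactor _ _ _ _ _ _) -/L in u0E.
have [r1m r1V _] := prodfam_marked ltP tlP d fv' v'0.
(* The right side is free of [z] while [L] is monic of degree one in [z], so both sides vanish and
   [L] divides [u 0]. *)
have e1 : L * (u 1%N - r 1%N * t) = r 1%N * rho.
  rewrite mulrBr [L * u 1%N](cross 1%N 0%N) // u0E; ring.
have rho0 : rho = 0.
  apply: (tmonic_reg ltP tlP r1m); rewrite -[LHS]e1.
  rewrite (tmonic_mul_ydeg ltP tlP hL (q := u 1%N - r 1%N * t)) ?mulr0 //.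
  by rewrite e1; apply: ydeg_le_free (vfreeM r1V rhoV).
exists t => // l lv.
have ut : u l = t * r l.
  apply: (tmonic_cancel ltP tlP hL); rewrite [L * u l](cross l 0%N) // u0E rho0; ring.
(* The difference [w l - t * f l.+1] is a combination of the [f k.+1] with zero coefficient at
   [y ^ a], so [comb_eq0] applies. *)
apply/eqP; rewrite -subr_eq0; apply/eqP.
pose e k := c l k - (if k == l then t else 0).
have eE (g : nat -> {mpoly A[n]}) : \sum_(k < size v) e k * g k =
    \sum_(k < size v) c l k * g k - t * g l.
  by rewrite -(sum_delta t g lv) -sumrB; apply: eq_bigr => i _; rewrite mulrBl.
have [cV ->] := hc l lv; rewrite -(eE (fun k => f k.+1)) comb_eq0 // => [k|].
  by apply: supportedB; [exact: cV|exact: vfree_if].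
rewrite eE -sE // suE // ut prE // mulrCA subrr; exact: supported0.
Qed.

Lemma prodfam_surj_step (d : param n -> A) : (0 < size v)%N ->
  (forall l, (l < size v)%N -> p l = prodfam tl (y :: V) v d l) ->
  exists d', forall l, (l < (size v).+1)%N -> f l = prodfam tl V ((y, a) :: v) d' l.
Proof.
have [fv yV yv] := fresh_cons fr => v0 pE.
have [t tV wE] := spair_multiplier v0 pE.
have [m0 f0V red0] := hf.1 0%N isT; have [m1 f1V _] := hf.1 1%N v0.
have [pm0 _ _] := ycoef_marked v0.
have fE l : (l < size v)%N -> ('X_y - t) * f l.+1 = p l * f 0.
  by move=> lv; rewrite mulrBl -wE // /w opprB addrC subrK.
(* That [t] lies in the tail of [y] follows from [(y - t) * f 1 = p 0 * f 0], where [f 1] and the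
   right side are monic. *)
have hL : tmonic tl U_(y)%MM ('X_y - t).
  apply: (tmonic_div ltP tlP m1); rewrite mulrC fE // genJS // [X in tmonic _ X]addmC addmA [X in tmonic _ X]addmC -mulmS.
  exact: (tmonicM ltP tlP).
have [F [r [f0E FV rV]]] := vfree_divX yV tV f0V.
have e l : (l < size v)%N -> ('X_y - t) * (f l.+1 - p l * F) = p l * r.
  by move=> lv; rewrite mulrBr fE // f0E; ring.
have hL1 : tmonic tl (U_(y) *+ 1)%MM ('X_y - t) by rewrite mulm1n.
(* By [e], multiplying by [y - t] gives [p 0 * r], which is free of [y]. So this difference
   vanishes, and then [r] does, as [p 0] is not a zero divisor. *)
have fF : f 1%N - p 0%N * F = 0.
  apply: (tmonic_mul_ydeg ltP tlP hL1); rewrite e //.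
  exact: ydeg_le_free (vfreeM (ycoef_vfree v0) rV).
have r0 : r = 0 by apply: (tmonic_reg ltP tlP pm0); rewrite -e // fF mulr0.
rewrite r0 addr0 in f0E.
have fSE l : (l < size v)%N -> f l.+1 = F * p l.
  move=> lv; apply/eqP; rewrite -subr_eq0 mulrC; apply/eqP/(tmonic_reg ltP tlP hL).
  by rewrite e // r0 mulr0.
have hF : tmonic tl (U_(y) *+ a)%MM F.
  apply: (tmonic_div ltP tlP pm0); rewrite mulrC -fSE // addmC -genJS //.
pose E := ycoef y a (f 0).
(* Comparing coefficients of [y ^ a] in [f 0 = (y - t) * F] puts [t] in the form used by
   [linfactor]. *)
have tE : t = ycoef y a ('X_y * F) - E.
  rewrite /E f0E mulrBl raddfB /= [t * F]mulrC (tmonic_ycoefM ltP tlP hF tV).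
  by rewrite opprB addrC subrK.
have [r' f0E' hr'] := (tmonic_tl ltP tlP _ _).1 m0.
have gE : genJ ((y, a) :: v) 0 = (U_(y) *+ a.+1)%MM by [].
have Er : E = ycoef y a r'.
  by rewrite /E f0E' raddfD /= ycoefX gE mulm_yE gtn_eqF // add0r.
have E1 : supported (tl U_(y)%MM) E.
  by rewrite Er; apply: (ycoef_tl tlP); rewrite -mulmS -gE.
have E2 : vfree (y :: V) E by exact: ycoef_free.
have E3 : reduced v E.
  rewrite Er; move: red0; rewrite f0E' addrAC subrr add0r.
  by move/(reduced_cons a _ yv) => [].
pose d' (k : param n) := if k.1.1 == y then (if k.1.2 then E@_k.2 else F@_k.2) else d k.
have FE : F = powpoly tl V y a d'.
  by apply: powpoly_surj => // b; rewrite /d' /= eqxx.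
have EE : E = linpoly tl V y v d'.
  by apply: linpoly_surj => // b; rewrite /d' /= eqxx.
exists d' => l /=; case: nilP => [vE|_]; first by rewrite vE in v0.
case: l => [_|l]; first by rewrite /linfactor -FE -EE -tE mulrC.
rewrite ltnS => lv; rewrite fSE // -FE pE //; congr (_ * _).
apply: prodfam_ext => k /params_var kv; rewrite /d'; case: eqP => // ky.
by move: yv; rewrite -ky kv.
Qed.

End Step.

Lemma prodfam_surj V v f : fresh V v -> standard_basis tl V v f ->
  exists d, forall l, (l < size v)%N -> f l = prodfam tl V v d l.
Proof.
elim: v V f => [|[y a] v IH] V f fr hf; first by exists (fun=> 0).
have [fv yV yv] := fresh_cons fr.
have [vE|/eqP vN] := v =P [::]; last first.
  have [d hd] := IH _ _ fv (ycoef_standard fr hf).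
  by apply: (prodfam_surj_step fr hf _ hd); case: (v) vN.
rewrite vE in hf *; have [m0 f0V _] := hf.1 0%N isT.
by exists (fun k => (f 0%N)@_k.2) => -[|//] _ /=; apply: powpoly_surj.
Qed.

End Factorization.

(** * Buchberger's criterion *)

(** For unfolding a well-founded recursion whose calls receive their proof of decrease from a
    boolean test. *)
Lemma reflect_caseE (P : Prop) (c : bool) (T : Type) (rec : P -> T) (x : T)
  (r : reflect P c) (h : P) : (if r is ReflectT h' then rec h' else x) = rec h.
Proof. by case: r => // h'; congr rec; exact: Prop_irrelevance. Qed.

Section Buchberger.
Variables (n : nat) (lt : rel 'X_{1..n}) (tl : 'X_{1..n} -> set 'X_{1..n}).
Hypotheses (ltP : term_order lt) (tlP : tail_order lt tl).
Variables (I : finType) (g : I -> 'X_{1..n}).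
Implicit Types (m b : 'X_{1..n}) (i j : I).

Section LowSpan.
Variables (A : comNzRingType) (f : I -> {mpoly A[n]}).

(** For [m] the least common multiple of two leading monomials, the usual S-pair condition: a
    combination of multiples of the [f i] with all leading monomials below [m]. *)
Definition lowspan m (p : {mpoly A[n]}) : Prop :=
  exists2 s : seq (A * 'X_{1..n} * I),
    (forall x, x \in s -> lt (x.1.2 + g x.2)%MM m) &
    p = \sum_(x <- s) x.1.1 *: ('X_[x.1.2] * f x.2).

Definition spairing i j : {mpoly A[n]} :=
  let l := mlcm (g i) (g j) in
  'X_[(l - g i)%MM] * f i - 'X_[(l - g j)%MM] * f j.

Hypothesis hf : forall i, tmonic tl (g i) (f i).
Hypothesis hS : forall i j, lowspan (mlcm (g i) (g j)) (spairing i j).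

Let divisor m : option I := [pick i | (g i <= m)%MM].

Definition nf_step m (rec : forall b, lt b m -> {mpoly A[n]}) : {mpoly A[n]} :=
  if divisor m is Some i then
    - \sum_(b <- msupp (f i) | b != g i)
        (f i)@_b *: (if @idP (lt (m - g i + b)%MM m) is ReflectT h
                     then rec (m - g i + b)%MM h else 0)
  else 'X_[m].

(* Buchberger's criterion over a ring: reducing each monomial by one fixed
   divisor defines a linear normal form, and the S-pairs make it vanish on all
   multiples of the [f i], whatever divisor was chosen. *)
Definition nfX : 'X_{1..n} -> {mpoly A[n]} :=
  Fix (term_order_wf ltP) (fun=> {mpoly A[n]}) nf_step.

Lemma nfXE m : nfX m = if divisor m is Some i then
    - \sum_(b <- msupp (f i) | b != g i) (f i)@_b *: nfX (m - g i + b)%MM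
  else 'X_[m].
Proof.
rewrite /nfX Fix_eq => [|x h k hk]; last first.
  by congr nf_step; apply: functional_extensionality_dep => y;
    apply: functional_extensionality_dep => z; exact: hk.
rewrite /nf_step /divisor; case: pickP => // i gm; congr (- _).
rewrite big_seq_cond [RHS]big_seq_cond; apply: eq_bigr => b /andP[bf nb].
congr (_ *: _).
have ltb : lt (m - g i + b)%MM m.
  rewrite -[X in lt _ X](submK gm) (lt_add2l ltP).
  by have [|/(tl_lt tlP)//] := (hf i).2 b bf; move/eqP: nb.
exact: reflect_caseE.
Qed.

Local Notation nf := (mlin nfX).

Lemma nf_divisor m i : divisor m = Some i -> nf ('X_[m - g i] * f i) = 0.
Proof.
move=> dm; have gm : (g i <= m)%MM by move: dm; rewrite /divisor; case: pickP => // j ? [<-].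
have -> : 'X_[m - g i] * f i = 'X_[m] +
    \sum_(b <- msupp (f i) | b != g i) (f i)@_b *: 'X_[(m - g i + b)%MM].
  rewrite {1}[f i]mpolyE (bigD1_seq (g i)) ?msupp_uniq //=; last first.
    by rewrite mcoeff_msupp (hf i).1 oner_neq0.
  rewrite (hf i).1 scale1r mulrDr -mpolyXD submK // mulr_sumr; congr (_ + _).
  by apply: eq_bigr => b _; rewrite -scalerAr mpolyXD.
rewrite raddfD /= raddf_sum /= [nf 'X_[m]]mlinX nfXE dm addrC; apply/eqP.
rewrite subr_eq0; apply/eqP; apply: eq_bigr => b _.
by rewrite linearZ /= [nf _]mlinX.
Qed.

Lemma nf_multiple m i : nf ('X_[m] * f i) = 0.
Proof.
move: {2}(m + g i)%MM (erefl (m + g i)%MM) => M.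
elim/(well_founded_ind (term_order_wf ltP)): M => M IH in m i * => mM.
have [j dM] : exists j, divisor M = Some j.
  by rewrite /divisor; case: pickP => [j|/(_ i)]; [exists j|rewrite -mM lem_addl].
have gM : (g j <= M)%MM by move: dM; rewrite /divisor; case: pickP => // ? ? [<-].
have iM : (g i <= M)%MM by rewrite -mM lem_addl.
set l := mlcm (g i) (g j).
have lM : (l <= M)%MM by rewrite lem_mlcm iM.
(* The multiple with leading monomial [M] is exchanged for the one the normal form uses, which it
   kills by construction; the S-pair term consists of multiples below [M]. *)
have e : 'X_[m] * f i = 'X_[M - l] * spairing i j + 'X_[M - g j] * f j.
  rewrite /spairing -/l mulrBr !mulrA -!mpolyXD.
  have eq h : (h <= l)%MM -> (M - l + (l - h) = M - h)%MM.
    by move=> hl; rewrite addmBA // submK.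
  by rewrite !eq ?lem_mlcml ?lem_mlcmr // subrK -mM addmK.
rewrite e raddfD /= nf_divisor // addr0; have [s sl ->] := hS i j.
rewrite mulr_sumr raddf_sum big1_seq //= => x xs.
rewrite -scalerAr linearZ /= mulrA -mpolyXD (IH _ _ _ _ erefl) ?scaler0 //.
by rewrite -addmA -{2}(submK lM) (lt_add2l ltP) sl.
Qed.

Lemma nf_supported p : supported (fun b => forall i, ~~ (g i <= b)%MM) p -> nf p = p.
Proof.
move=> hp; rewrite [RHS]mpolyE /mlin big_seq [RHS]big_seq.
apply: eq_bigr => b /hp hb; rewrite nfXE /divisor; case: pickP => // i gb.
by have := hb i; rewrite gb.
Qed.

Lemma buchberger (c : I -> {mpoly A[n]}) :
  supported (fun b => forall i, ~~ (g i <= b)%MM) (\sum_i c i * f i) ->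
  \sum_i c i * f i = 0.
Proof.
move=> /nf_supported <-; rewrite raddf_sum big1 //= => i _.
rewrite [c i]mpolyE mulr_suml raddf_sum big1 // => m _.
by rewrite /= -scalerAl linearZ /= nf_multiple scaler0.
Qed.

End LowSpan.

End Buchberger.

(** * The ideals J(a_q, ..., a_1) *)

Section MinimalGenerators.
Variable n : nat.
Implicit Types (v : seq ('I_n * nat)) (g h m : 'X_{1..n}).

Lemma gens_neq0 v : 0%MM \notin gens v.
Proof.
elim: v => //= -[y a] v IH; rewrite inE negb_or; apply/andP; split.
  by apply/eqP => /(congr1 (fun m : 'X_{1..n} => m y)); rewrite mulm_yE mnm0E.
apply/mapP => -[h hv] /esym/eqP; rewrite mnmD_eq0 => /andP[_ /eqP h0].
by move: IH; rewrite -h0 hv.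
Qed.

Lemma gens_uniq v : uniq (unzip1 v) -> uniq (gens v).
Proof.
elim: v => //= -[y a] v IH /= /andP[yv uv].
rewrite map_inj_uniq ?IH ?andbT //; last exact: addmI.
apply/mapP => -[h hv] /(congr1 (fun m : 'X_{1..n} => m y)).
rewrite mnmDE !mulm_yE (gens_free (V := [:: y]) _ hv) ?inE //; last first.
  by move=> z; rewrite inE => /eqP->.
by rewrite addn0 => /eqP; rewrite eqn_leq ltnn.
Qed.

(** The inner generators are free of [y], so [y ^ (a + 1)] divides no [y ^ a * h]; the converse
    division would force [h = 1], excluded by [gens_neq0]. *)
Lemma gens_antichain v g h : uniq (unzip1 v) -> g \in gens v -> h \in gens v ->
  (g <= h)%MM -> g = h.
Proof.
elim: v g h => // -[y a] v IH g h /= /andP[yv uv].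
have hy l : l \in gens v -> l y = 0%N.
  move=> lv; apply: (gens_free (V := [:: y])) lv _ _; rewrite ?inE // => z.
  by rewrite inE => /eqP->.
rewrite !inE => /orP[/eqP->|/mapP[g' gv ->]] /orP[/eqP->|/mapP[h' hv ->]] // /mnm_lepP le.
- by have := le y; rewrite mnmDE !mulm_yE hy // addn0 ltnn.
- case/negP: (gens_neq0 v); rewrite (_ : 0%MM = g') //; apply/mnmP => z.
  rewrite mnm0E; have [->|zy] := eqVneq z y; first by rewrite hy.
  by have := le z; rewrite mnmDE !mulm_yNE // leqn0 => /eqP.
congr (_ + _)%MM; apply: IH => //; apply/mnm_lepP => z.
by have := le z; rewrite !mnmDE leq_add2l.
Qed.

Lemma min_gensP (k : fieldType) (J : {pred {mpoly k[n]}}) v m : uniq (unzip1 v) ->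
  (forall b, ('X_[b] \in J) = inJ v b) -> (m \in gens v) <-> min_gens J m.
Proof.
move=> uv JE; split=> [mv|[]].
  split=> [|d]; rewrite JE inJP //; first by apply/hasP; exists m; rewrite // lepm_refl.
  move=> /hasP[g gv gd] dm.
  have e : g = m by apply: gens_antichain uv gv mv _; exact: lepm_trans gd dm.
  by apply/mnmP => z; apply/eqP; rewrite eqn_leq (mnm_lepP dm) -e (mnm_lepP gd).
rewrite JE inJP // => /hasP[g gv gm] mmin; rewrite -(mmin g) // JE inJP //.
by apply/hasP; exists g; rewrite // lepm_refl.
Qed.

End MinimalGenerators.

Section JSequence.
Variables (k : fieldType) (n : nat) (a : nat -> nat).

Local Notation y j := (inord (n - j) : 'I_n.+1).

(* [jseq s r] encodes J(a_q, ..., a_1) for [q = s + r + 1], when [a_(s+1)] is the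
   first non-zero exponent. *)
Fixpoint jseq (s r : nat) : seq ('I_n.+1 * nat) :=
  if r is r'.+1 then (y (s + r).+1, a (s + r).+1) :: jseq s r'
  else [:: (y s.+1, (a s.+1).-1)].

Definition jmnm (i q : nat) : 'X_{1..n.+1} :=
  (\sum_(i <= j < q.+1) U_(y j) *+ a j)%MM.

Lemma idealJ_prodE q i : idealJ_prod k n q a i = 'X_[jmnm i q].
Proof.
rewrite /idealJ_prod /jmnm -mprodXE; apply: eq_bigr => j _.
by rewrite mpolyXn.
Qed.

Lemma mem_unzip1_jseq s r x : x \in unzip1 (jseq s r) ->
  exists2 j, (j <= (s + r).+1)%N & x = y j.
Proof.
elim: r => [|r IH] /=; rewrite inE.
  by move/eqP->; exists s.+1; rewrite ?addn0.
case/orP=> [/eqP->|/IH[j hj ->]]; first by exists (s + r.+1).+1.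
by exists j => //; rewrite addnS (leq_trans hj).
Qed.

Lemma uniq_jseq s r : (s + r < n)%N -> uniq (unzip1 (jseq s r)).
Proof.
elim: r => // r IH; rewrite addnS => h /=; rewrite IH ?(ltnW h) // andbT.
apply/negP => /mem_unzip1_jseq[j hj] /(congr1 val); rewrite /= !inordK ?ltnS ?leq_subr //.
(* All indices are at most [n], so the subtraction is not truncated and distinct indices give
   distinct variables. *)
move=> e; have : (n - (n - (s + r.+1).+1) = n - (n - j))%N by rewrite e.
by rewrite !subKn //; lia.
Qed.

Lemma mem_gens_jseq s r m : a s.+1 != 0%N ->
  m \in gens (jseq s r) <->
  (exists2 i, (s.+2 <= i <= (s + r).+1)%N & m = (U_(y i) + jmnm i (s + r).+1)%MM)
  \/ m = jmnm s.+1 (s + r).+1.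
Proof.
move=> as1; elim: r m => [|r IH] m /=.
  rewrite addn0 inE prednK ?lt0n // /jmnm big_nat1.
  split=> [/eqP->|[[i]|->//]]; [by right|].
  by rewrite ltnNge andNb.
have recr i : (i <= (s + r).+2)%N ->
    jmnm i (s + r.+1).+1 = (U_(y (s + r.+1).+1) *+ a (s + r.+1).+1 + jmnm i (s + r).+1)%MM.
  by move=> h; rewrite /jmnm addnS big_nat_recr //= addmC.
rewrite inE; split.
  case/orP=> [/eqP->|/mapP[h /IH[[i hi ->]|->] ->]].
  - left; exists (s + r.+1).+1; first by rewrite leqnn andbT; lia.
    by rewrite /jmnm big_nat1 mulmS.
  - left; exists i; first by lia.
    by rewrite recr; [rewrite !addmA [(U_(_) + _)%MM]addmC|lia].
  - by right; rewrite recr //; lia.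
case=> [[i hi ->]|->]; last first.
  by rewrite recr; [apply/orP; right; apply/map_f/IH; right|lia].
(* The top index gives the pure power [y ^ (a + 1)]; every other generator is [y ^ a] times a
   generator of the inner ideal. *)
have [->|ne] := eqVneq i (s + r.+1).+1.
  by rewrite /jmnm big_nat1 mulmS eqxx.
rewrite recr; last by lia.
apply/orP; right; apply/mapP; exists (U_(y i) + jmnm i (s + r).+1)%MM.
  by apply/IH; left; exists i => //; lia.
by rewrite !addmA [(U_(y i) + _)%MM]addmC.
Qed.

Lemma idealJ_sP q : (\sum_(1 <= i < q.+1) a i)%N <> 0%N ->
  (idealJ_s q a < q)%N /\ a (idealJ_s q a).+1 != 0%N.
Proof.
move=> h; have hs : has (fun s => a s.+1 != 0%N) (iota 0 q).
  apply: contrapT => /negP/hasPn h'; apply: h; rewrite big_add1 /= big_nat big1 // => i hi.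
  by apply/eqP/negPn/h'; rewrite mem_iota.
have lt : (idealJ_s q a < q)%N by move: hs; rewrite has_find size_iota.
by split=> //; have := nth_find 0%N hs; rewrite nth_iota.
Qed.

Lemma mem_idealJ s r q : q = (s + r).+1 -> idealJ_s q a = s -> a s.+1 != 0%N ->
  (q <= n)%N -> forall m, ('X_[m] \in idealJ k n q a) = inJ (jseq s r) m.
Proof.
move=> qE sE as1 qn m; have uv : uniq (unzip1 (jseq s r)) by apply: uniq_jseq; lia.
have gensE p : @idealJ_gens k n q a p <-> exists2 g, g \in gens (jseq s r) & p = 'X_[g].
  rewrite /idealJ_gens sE; split=> [[[i hi ->]|->]|[g /(mem_gens_jseq _ _ as1)[[i hi ->]|->] ->]].
  - exists (U_(y i) + jmnm i q)%MM; last by rewrite idealJ_prodE mpolyXD.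
    by apply/mem_gens_jseq => //; left; exists i; rewrite -?qE.
  - exists (jmnm s.+1 q); last by rewrite idealJ_prodE.
    by apply/mem_gens_jseq => //; right; rewrite -qE.
  - by left; exists i; rewrite ?qE // idealJ_prodE mpolyXD.
  - by right; rewrite idealJ_prodE qE.
apply/idP/idP => [/ideal_genP[t tg mE]|].
  have : supported (inJ (jseq s r)) ('X_[m] : {mpoly k[n.+1]}).
    rewrite mE; apply: supported_sum => p /tg/gensE[g gv ->].
    apply: (@supportedM _ _ (fun=> True) (eq g)) => //; last exact: supportedX.
    by move=> b _ _ <-; rewrite inJP //; apply/hasP; exists g; rewrite // lem_addl.
  by apply; rewrite msuppX inE.
rewrite inJP // => /hasP[g gv gm]; apply/ideal_genP.
exists [:: ('X_[m - g], 'X_[g])]; last by rewrite big_seq1 /= -mpolyXD submK.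
by move=> p; rewrite inE => /eqP->; apply/gensE; exists g.
Qed.

End JSequence.

(** * The coordinate ring of the stratum *)

Section Quotient.
Variable k : fieldType.

Lemma mpoly_rmorph_eq (M : nat) (B : nzRingType) (f g : {rmorphism {mpoly k[M]} -> B}) :
  (forall c, f c%:MP = g c%:MP) -> (forall i, f 'X_i = g 'X_i) -> f =1 g.
Proof.
move=> hC hX p; rewrite [p]mpolyE !rmorph_sum; apply: eq_bigr => m _ /=.
rewrite -mul_mpolyC !rmorphM /= hC mpolyXE_id !rmorph_prod; congr (_ * _).
by apply: eq_bigr => i _ /=; rewrite !rmorphXn /= hX.
Qed.

Lemma ideal_gen_ker (R : comAlgType k) (S : pzRingType) (A : set R) (f : {rmorphism R -> S}) :
  (forall c, A c -> f c = 0) -> forall x, x \in ideal_gen A -> f x = 0.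
Proof.
move=> h x /ideal_genP[s sA ->]; rewrite rmorph_sum big1_seq //= => p ps.
by rewrite rmorphM /= (h p.2) ?mulr0 //; exact: sA.
Qed.

(** [f] factors through the quotient as [g], and the two identities make [h] its inverse. The
    quantification over [B] lets the coordinate ring enter only as a non-zero ring in which the
    equations hold. *)
Lemma affine_space_of_retraction (M N : nat) (A : set {mpoly k[M]})
    (f : {rmorphism {mpoly k[M]} -> {mpoly k[N]}}) :
  scalable f -> (forall c, A c -> f c = 0) ->
  (forall (B : comNzRingType) (pi : {rmorphism {mpoly k[M]} -> B})
      (g : {rmorphism B -> {mpoly k[N]}}),
    (forall x, g (pi x) = f x) -> (forall c, A c -> pi c = 0) ->
    exists h : {mpoly k[N]} -> B, (forall x, h (f x) = pi x) /\ cancel h g) ->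
  closed_subscheme_is_affine_space A.
Proof.
move=> fZ fA; pose Q := quot_alg A; pose g (x : Q) := f (repr x).
have gE x : g (quot_pi A x) = f x.
  apply/eqP; rewrite eq_sym -subr_eq0 -rmorphB.
  by rewrite (ideal_gen_ker fA) // repr_quot_pi.
have gB : zmod_morphism g.
  move=> x y; rewrite -(quot_pi_repr x) -(quot_pi_repr y).
  have -> : quot_pi A (repr x) - quot_pi A (repr y) = quot_pi A (repr x - repr y).
    by apply/eqP; rewrite subr_eq -quot_piD subrK.
  by rewrite !gE rmorphB.
have gM : monoid_morphism g.
  split=> [|x y]; first by rewrite -[1]/(quot_pi A 1) gE rmorph1.
  rewrite -(quot_pi_repr x) -(quot_pi_repr y).
  by rewrite -[_ * _]/(quot_mul _ _) -quot_piM !gE rmorphM.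
pose g1 := GRing.isZmodMorphism.Build _ _ g gB.
pose g2 := GRing.isMonoidMorphism.Build _ _ g gM.
pose gm : {rmorphism Q -> {mpoly k[N]}} := HB.pack g g1 g2.
(* The quotient is non-zero because [g] maps it, preserving 1, to a polynomial ring. *)
have nz : (1 : Q) != 0.
  apply/eqP => e; have := rmorph1 gm; rewrite e rmorph0.
  by move/esym/eqP; rewrite oner_eq0.
pose B : comNzRingType := HB.pack Q (GRing.PzSemiRing_isNonZero.Build Q nz).
pose pi (x : {mpoly k[M]}) : B := quot_pi A x.
have piB : zmod_morphism pi.
  by move=> x y; apply/eqP; rewrite eq_sym subr_eq -[_ + _]quot_piD subrK.
have piM : monoid_morphism pi by split=> // x y; exact: quot_piM.
pose pi1 := GRing.isZmodMorphism.Build _ _ pi piB.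
pose pi2 := GRing.isMonoidMorphism.Build _ _ pi piM.
pose pim : {rmorphism {mpoly k[M]} -> B} := HB.pack pi pi1 pi2.
pose g1' := GRing.isZmodMorphism.Build B _ g gB.
pose g2' := GRing.isMonoidMorphism.Build B _ g gM.
pose gm' : {rmorphism B -> {mpoly k[N]}} := HB.pack g g1' g2'.
case/(_ B pim gm' gE) => [c Ac|h [hf hg]].
  by rewrite -(rmorph0 pim); apply/quot_pi_eq; rewrite subr0; apply/ideal_genP; exists [:: (1, c)];
    [move=> p; rewrite inE => /eqP->|rewrite big_seq1 mul1r].
exists N, gm; split.
  move=> c x /=; rewrite -(quot_pi_repr x) -[_ *: _]/(quot_scale _ _) -quot_piZ !gE.
  exact: fZ.
exists h => [x|]; last exact: hg.
by rewrite -(quot_pi_repr x) /= gE hf.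
Qed.

End Quotient.

(** * The generic generators and their specializations *)

Section Stratum.
Variables (k : fieldType) (n : nat) (lt : rel 'X_{1..n}).
Variables (tl : 'X_{1..n} -> set 'X_{1..n}).
Hypotheses (ltP : term_order lt) (tlP : tail_order lt tl).
Variables (J : {pred {mpoly k[n]}}) (v : seq ('I_n * nat)).
Hypotheses (fr : fresh [::] v) (JE : forall m, ('X_[m] \in J) = inJ v m).

Let uv : uniq (unzip1 v) := fr.1.

Local Notation I := 'I_(ngens J).
Local Notation C := {mpoly k[#|cvar J tl|]}.

Lemma mem_gens m : (m \in gens v) = (m \in fset_set (min_gens J)).
Proof.
rewrite in_fset_set; last exact: min_gens_finite.
apply/idP/idP => [/(min_gensP _ uv JE)/mem_set//|/set_mem].
by move/(min_gensP _ uv JE).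
Qed.

Definition gen_index (i : I) : nat := index (gen i) (gens v).

Lemma gen_mem (i : I) : gen i \in gens v.
Proof. by rewrite mem_gens; apply: mem_nth; exact: ltn_ord. Qed.

Lemma gen_index_lt i : (gen_index i < size v)%N.
Proof. by rewrite -size_gens index_mem gen_mem. Qed.

Lemma genJ_index i : genJ v (gen_index i) = gen i.
Proof. by rewrite /genJ nth_index // gen_mem. Qed.

Lemma gen_exists l : (l < size v)%N -> exists i : I, gen i = genJ v l.
Proof.
move=> /genJ_mem; rewrite mem_gens => h.
have il : (index (genJ v l) (enum_fset (fset_set (min_gens J))) < ngens J)%N.
  by rewrite index_mem.
by exists (Ordinal il); rewrite /gen /= nth_index.
Qed.

Lemma gen_tailP (i : I) b : reflect (tl (gen i) b /\ ~~ inJ v b) (b \in gen_tail tl i).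
Proof.
rewrite /gen_tail in_fset_set.
  by apply: (iffP idP) => [/set_mem|[h1 h2]]; [|apply/mem_set]; rewrite /= JE.
by apply: (sub_finite_set _ (tl_fin tlP (gen i))) => c [].
Qed.

Section Specialization.
Variables (B : comNzRingType) (phi : {rmorphism C -> B}).

Lemma map_gen_poly (i : I) : map_mpoly phi (gen_poly tl i) =
  'X_[gen i] + \sum_(b : gen_tail tl i) phi (coef_var b) *: 'X_[val b].
Proof.
rewrite rmorphD /= map_mpolyX rmorph_sum /=; congr (_ + _).
by apply: eq_bigr => b _ /=; rewrite map_mpolyZ map_mpolyX.
Qed.

Lemma map_gen_poly_tail (i : I) : supported (fun b => b \in gen_tail tl i)
  (map_mpoly phi (gen_poly tl i) - 'X_[gen i]).
Proof.
rewrite map_gen_poly addrAC subrr add0r; apply: supported_sum => b _.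
by apply: supportedZ; apply: supportedX; exact: valP.
Qed.

Lemma map_gen_poly_tmonic (i : I) : tmonic tl (gen i) (map_mpoly phi (gen_poly tl i)).
Proof.
apply/(tmonic_tl ltP tlP); exists (map_mpoly phi (gen_poly tl i) - 'X_[gen i]).
  by rewrite addrC subrK.
by apply: supportedW (@map_gen_poly_tail i) => b /gen_tailP[].
Qed.

Lemma map_gen_polyE (i : I) p : tmonic tl (gen i) p -> reduced v (p - 'X_[gen i]) ->
  (forall b : gen_tail tl i, phi (coef_var b) = p@_(val b)) ->
  map_mpoly phi (gen_poly tl i) = p.
Proof.
move=> /(tmonic_tl ltP tlP)[r -> hr]; rewrite addrAC subrr add0r => red hb.
rewrite map_gen_poly; congr (_ + _).
rewrite [RHS](@mpoly_fset _ _ (gen_tail tl i)) => [|b br]; last first.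
  by apply/gen_tailP; split; [exact: hr|exact: red].
rewrite big_seq_fsetE /=; apply: eq_bigr => b _; rewrite hb mcoeffD mcoeffX.
case: eqP => [e|_]; last by rewrite add0r.
by have /gen_tailP[] := valP b; rewrite -e => /(tl_irr ltP tlP).
Qed.

Lemma map_gen_comb (c : I -> {mpoly C[n]}) :
  map_mpoly phi (\sum_i c i * gen_poly tl i) =
  \sum_i map_mpoly phi (c i) * map_mpoly phi (gen_poly tl i).
Proof. by rewrite rmorph_sum; apply: eq_bigr => i _ /=; rewrite rmorphM. Qed.

End Specialization.

Lemma spoly_lt (i j : I) :
  supported (fun b => lt b (mlcm (gen i) (gen j))) (spoly tl i j).
Proof.
have h (i' : I) : (gen i' <= mlcm (gen i) (gen j))%MM ->
    supported (fun b => lt b (mlcm (gen i) (gen j)))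
      ('X_[mlcm (gen i) (gen j) - gen i'] * gen_poly tl i' - 'X_[mlcm (gen i) (gen j)]).
  move=> le; rewrite -[X in _ - 'X_[X]](submK le) mpolyXD -mulrBr.
  apply: (@supportedM _ _ (eq (mlcm (gen i) (gen j) - gen i')%MM) (tl (gen i'))).
  - move=> _ c <- /(tl_lt tlP) hc.
    by rewrite -[X in lt _ X](submK le) (lt_add2l ltP).
  - exact: supportedX.
  rewrite /gen_poly addrAC subrr add0r; apply: supported_sum => b _.
  by apply: supportedZ; apply: supportedX; have /gen_tailP[] := valP b.
have -> : spoly tl i j = ('X_[mlcm (gen i) (gen j) - gen i] * gen_poly tl i
    - 'X_[mlcm (gen i) (gen j)]) - ('X_[mlcm (gen i) (gen j) - gen j] * gen_poly tl j
    - 'X_[mlcm (gen i) (gen j)]) by rewrite /spoly opprB addrA subrK.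
by apply: supportedB; apply: h; [exact: lem_mlcml|exact: lem_mlcmr].
Qed.

Lemma lowspan0 (A : comNzRingType) (f : I -> {mpoly A[n]}) m :
  lowspan lt (@gen _ _ J) f m 0.
Proof. by exists [::]; rewrite ?big_nil. Qed.

Lemma lowspanD (A : comNzRingType) (f : I -> {mpoly A[n]}) m p q :
  lowspan lt (@gen _ _ J) f m p -> lowspan lt (@gen _ _ J) f m q ->
  lowspan lt (@gen _ _ J) f m (p + q).
Proof.
move=> [s hs ->] [t ht ->]; exists (s ++ t); last by rewrite big_cat.
by move=> x; rewrite mem_cat => /orP[/hs|/ht].
Qed.

(** Each step subtracts a multiple whose leading monomial occurs in the current polynomial, so all
    monomials stay below [m]. *)
Lemma reduction_lowspan (f h : {mpoly C[n]}) m :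
  clos_refl_trans _ (@reduction_step _ _ J tl) f h ->
  supported (fun b => lt b m) f ->
  supported (fun b => lt b m) h /\ lowspan lt (@gen _ _ J) (gen_poly tl) m (f - h).
Proof.
elim=> [{}f {}h [i [c [cf ->]]] fm|{}f fm|x y z _ IH1 _ IH2 xm].
- have cm : lt (c + gen i)%MM m by exact: fm.
  split; last first.
    exists [:: (f@_(c + gen i)%MM, c, i)]; first by move=> x; rewrite inE => /eqP->.
    by rewrite big_seq1 /= opprB addrC subrK.
  apply: supportedB => //; apply: supportedZ.
  apply: (@supportedM _ _ (eq c) (fun b => b = gen i \/ tl (gen i) b)).
  + move=> _ b <- [->//|/(tl_lt tlP) hb].
    by apply: (term_trans ltP (y := (c + gen i)%MM)); rewrite ?(lt_add2l ltP).
  + exact: supportedX.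
  rewrite /gen_poly; apply: supportedD; first by apply: supportedX; left.
  apply: supported_sum => b _; apply: supportedZ; apply: supportedX; right.
  by have /gen_tailP[] := valP b.
- by split=> //; rewrite subrr; exact: lowspan0.
have [ym h1] := IH1 xm; have [zm h2] := IH2 ym; split=> //.
by rewrite -(subrK y x) -addrA; exact: lowspanD.
Qed.

Variable H : I -> I -> {mpoly C[n]}.
Hypothesis HP : spoly_reductions H.

Lemma spoly_lowspan (i j : I) : (i < j)%N ->
  lowspan lt (@gen _ _ J) (gen_poly tl) (mlcm (gen i) (gen j)) (spoly tl i j - H i j).
Proof. by move=> /HP[red _]; have [] := reduction_lowspan red (spoly_lt (j:=j)). Qed.

Lemma map_lowspan (B : comNzRingType) (phi : {rmorphism C -> B}) m p :
  lowspan lt (@gen _ _ J) (gen_poly tl) m p ->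
  lowspan lt (@gen _ _ J) (fun i => map_mpoly phi (gen_poly tl i)) m (map_mpoly phi p).
Proof.
move=> [s hs ->]; exists [seq (phi x.1.1, x.1.2, x.2) | x <- s].
  by move=> _ /mapP[x xs ->] /=; exact: hs.
rewrite big_map rmorph_sum; apply: eq_bigr => x _ /=.
by rewrite map_mpolyZ rmorphM /= map_mpolyX.
Qed.

Lemma map_spoly (B : comNzRingType) (phi : {rmorphism C -> B}) (i j : I) :
  map_mpoly phi (spoly tl i j) =
  spairing (@gen _ _ J) (fun i => map_mpoly phi (gen_poly tl i)) i j.
Proof. by rewrite /spoly rmorphB !rmorphM /= !map_mpolyX. Qed.

Lemma lowspanN (A : comNzRingType) (f : I -> {mpoly A[n]}) m p :
  lowspan lt (@gen _ _ J) f m p -> lowspan lt (@gen _ _ J) f m (- p).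
Proof.
move=> [s hs ->]; exists [seq (- x.1.1, x.1.2, x.2) | x <- s].
  by move=> _ /mapP[x xs ->] /=; exact: hs.
by rewrite big_map -sumrN; apply: eq_bigr => x _; rewrite scaleNr.
Qed.

(** Where the equations hold, each [H i j] specializes to zero, so the reductions express the
    S-pairs below the least common multiple and Buchberger's criterion applies. *)
Lemma eqs_independent (B : comNzRingType) (phi : {rmorphism C -> B}) :
  (forall c, stratum_eqs H c -> phi c = 0) ->
  forall c : I -> {mpoly B[n]},
  reduced v (\sum_i c i * map_mpoly phi (gen_poly tl i)) ->
  \sum_i c i * map_mpoly phi (gen_poly tl i) = 0.
Proof.
move=> phi0 c red; apply: (buchberger ltP tlP (g := @gen _ _ J)).
- exact: map_gen_poly_tmonic.
- have lt_case (i j : I) : (i < j)%N -> lowspan lt (@gen _ _ J)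
      (fun i => map_mpoly phi (gen_poly tl i)) (mlcm (gen i) (gen j))
      (spairing (@gen _ _ J) (fun i => map_mpoly phi (gen_poly tl i)) i j).
    move=> ij; have := map_lowspan phi (spoly_lowspan ij).
    rewrite rmorphB /= map_spoly (_ : map_mpoly phi (H i j) = 0) ?subr0 //.
    apply/mpolyP => b; rewrite mcoeff_map_mpoly mcoeff0; apply: (phi0).
    by exists i, j, b.
  move=> i j; have [ij|ji|/val_inj->] := ltngtP i j; first exact: lt_case.
    rewrite mlcmC -[spairing _ _ _ _]opprK; apply: lowspanN.
    rewrite (_ : - _ = spairing (@gen _ _ J) (fun i => map_mpoly phi (gen_poly tl i)) j i).
      exact: lt_case.
    by rewrite /spairing opprB mlcmC.
  by rewrite /spairing subrr; exact: lowspan0.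
apply: supportedW red => b hb i; apply: contraNN hb => ib.
by rewrite inJP //; apply/hasP; exists (gen i); rewrite // gen_mem.
Qed.

Lemma reduction_comb (i j : I) : (i < j)%N ->
  exists c : I -> {mpoly C[n]}, H i j = \sum_l c l * gen_poly tl l.
Proof.
pose K (p : {mpoly C[n]}) := exists c : I -> {mpoly C[n]}, p = \sum_l c l * gen_poly tl l.
have KB p q : K p -> K q -> K (p - q).
  move=> [c ->] [d ->]; exists (fun l => c l - d l).
  by rewrite -sumrB; apply: eq_bigr => l _; rewrite mulrBl.
have K1 p l : K (p * gen_poly tl l).
  exists (fun x => if x == l then p else 0); rewrite (bigD1 l) //= eqxx big1 ?addr0 //.
  by move=> x /negPf->; rewrite mul0r.
have K0 : K 0 by exists (fun=> 0); rewrite big1 // => l _; rewrite mul0r.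
move=> ij; have [s _ e] := spoly_lowspan ij.
have -> : H i j = spoly tl i j - (spoly tl i j - H i j) by rewrite opprB addrC subrK.
rewrite e; apply: (KB); first by apply: (KB); exact: K1.
apply: (big_ind K) => // [p q hp hq|x _].
  by rewrite -[q]opprK; apply: (KB) => //; rewrite -sub0r; exact: KB.
by rewrite scalerAl; exact: K1.
Qed.

End Stratum.

Lemma sum_by_index (R : pzRingType) (I : finType) (idx : I -> nat) (N : nat)
    (c : I -> R) (F : nat -> R) : (forall i, (idx i < N)%N) ->
  \sum_i c i * F (idx i) = \sum_(l < N) (\sum_(i | idx i == l) c i) * F l.
Proof.
move=> h; rewrite (partition_big (fun i => Ordinal (h i)) predT) //=.
by apply: eq_bigr => l _; rewrite mulr_suml; apply: eq_bigr => i /eqP <-.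
Qed.

Lemma map_mpoly_trans (n : nat) (A B D : nzRingType) (f : {rmorphism A -> B})
    (g : {rmorphism B -> D}) (h : {rmorphism A -> D}) :
  (forall x, g (f x) = h x) ->
  forall p : {mpoly A[n]}, map_mpoly g (map_mpoly f p) = map_mpoly h p.
Proof. by move=> gf p; apply/mpolyP => m; rewrite !mcoeff_map_mpoly /= gf. Qed.

(** * The mutually inverse morphisms *)

Section AffineStratum.
Variables (k : fieldType) (n : nat) (lt : rel 'X_{1..n}).
Variables (tl : 'X_{1..n} -> set 'X_{1..n}).
Hypotheses (ltP : term_order lt) (tlP : tail_order lt tl).
Variables (J : {pred {mpoly k[n]}}) (v : seq ('I_n * nat)).
Hypotheses (fr : fresh [::] v) (JE : forall m, ('X_[m] \in J) = inJ v m).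

Let uv : uniq (unzip1 v) := fr.1.

Local Notation I := 'I_(ngens J).
Local Notation C := {mpoly k[#|cvar J tl|]}.

Let coords := undup (params tl [::] v).
Let N := size coords.

(** The generic point of the affine space: every coordinate goes to its own variable, and the
    default 0 concerns only indices outside [coords]. *)
Let universal (c : param n) : {mpoly k[N]} :=
  if insub (index c coords) is Some i then 'X_(i : 'I_N) else 0.

Let ufam (l : nat) : {mpoly {mpoly k[N]}[n]} := prodfam tl [::] v universal l.

Let uval (x : 'I_#|cvar J tl|) : {mpoly k[N]} :=
  let b := enum_val x in (ufam (gen_index v (tag b)))@_(val (tagged b)).

Let Phi : {rmorphism C -> {mpoly k[N]}} := mmap (@mpolyC N k) uval.

Lemma gen_inj : injective (@gen _ _ J).
Proof.
by move=> i j /eqP; rewrite /gen nth_uniq ?fset_uniq ?ltn_ord // => /eqP/val_inj.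
Qed.

Lemma Phi_coef (i : I) (b : gen_tail tl i) :
  Phi (coef_var b) = (ufam (gen_index v i))@_(val b).
Proof. by rewrite /Phi /coef_var /= mmapX mmap1U /uval enum_rankK. Qed.

Lemma Phi_gen (i : I) : map_mpoly Phi (gen_poly tl i) = ufam (gen_index v i).
Proof.
have [h1 _ h3] := prodfam_marked ltP tlP universal fr (gen_index_lt fr JE i).
rewrite (genJ_index fr JE) in h1 h3.
apply: (map_gen_polyE ltP tlP JE h1 h3) => b; exact: Phi_coef.
Qed.

Lemma stratum_affine : stratum_is_affine_space J tl.
Proof.
move=> H HP; apply: (@affine_space_of_retraction _ _ _ _ Phi).
- by move=> c x; rewrite /Phi /= mmapZ mul_mpolyC.
- move=> _ [i [j [b [ij ->]]]].
  rewrite -mcoeff_map_mpoly (_ : map_mpoly Phi (H i j) = 0) ?mcoeff0 //.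
  have [c cE] := reduction_comb ltP tlP JE HP ij.
  (* The image of [H i j] is a combination of the universal product family and is reduced, hence
     zero; so [Phi] kills the equations. *)
  have e : map_mpoly Phi (H i j) = \sum_(l < size v)
      (\sum_(i' | gen_index v i' == l) map_mpoly Phi (c i')) * ufam l.
    rewrite cE map_gen_comb -(sum_by_index _ _ (gen_index_lt fr JE)).
    by apply: eq_bigr => i' _; rewrite Phi_gen.
  rewrite e; apply: (prodfam_standard ltP tlP universal fr).2
    (fun l => \sum_(i' | gen_index v i' == l) map_mpoly Phi (c i')) _ _ => //.
  rewrite -e.
  move=> m; rewrite mcoeff_msupp mcoeff_map_mpoly => nz.
  have [_ /(_ m)] := HP i j ij; rewrite JE; apply.
  by rewrite mcoeff_msupp; apply: contraNneq nz => ->; rewrite raddf0.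
move=> B pi g gpi pi0.
have /choice[iota hiota] : forall l : 'I_(size v), exists i : I, gen i = genJ v l.
  by move=> l; exact: gen_exists.
pose F (l : nat) : {mpoly B[n]} :=
  if insub l is Some l' then map_mpoly pi (gen_poly tl (iota l')) else 0.
have FE (l : 'I_(size v)) : F l = map_mpoly pi (gen_poly tl (iota l)).
  by rewrite /F valK.
have Fgen (i : I) : map_mpoly pi (gen_poly tl i) = F (gen_index v i).
  pose l := Ordinal (gen_index_lt fr JE i); rewrite -[gen_index _ _]/(val l) FE.
  by congr (map_mpoly _ (gen_poly _ _)); apply: gen_inj; rewrite hiota /= (genJ_index fr JE).
have hF : standard_basis tl [::] v F.
  split=> [l lv|c _].
    rewrite -[l]/(val (Ordinal lv)) FE -hiota; split=> //; first exact: (map_gen_poly_tmonic ltP tlP JE).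
    by move=> b /map_gen_poly_tail /(gen_tailP tlP JE)[].
  have -> : \sum_(l < size v) c l * F l = \sum_i (\sum_(l | iota l == i) c l) *
      map_mpoly pi (gen_poly tl i).
    rewrite (partition_big iota predT) //=; apply: eq_bigr => i _.
    by rewrite mulr_suml; apply: eq_bigr => l /eqP <-; rewrite FE.
  exact: (eqs_independent ltP tlP fr JE HP pi0).
(* The factorization over [B] yields the coordinates [d] of the given point, and [Psi] sends the
   variables to them. *)
have [d hd] := prodfam_surj ltP tlP fr hF.
pose Psi : {rmorphism {mpoly k[N]} -> B} :=
  mmap (pi \o @mpolyC _ k) (fun x : 'I_N => d (tnth (in_tuple coords) x)).
have PsiX : {in params tl [::] v, Psi \o universal =1 d}.
  move=> c; rewrite -mem_undup => cP; rewrite /= /universal.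
  have ic : (index c coords < N)%N by rewrite index_mem.
  by rewrite insubT /= mmapX mmap1U (tnth_nth c) /= nth_index.
have PsiC c : Psi c%:MP = pi c%:MP by rewrite /Psi /= mmapC.
have PhiC c : Phi c%:MP = c%:MP by rewrite /Phi /= mmapC.
exists Psi; split.
  apply: (@mpoly_rmorph_eq _ _ _ (Psi \o Phi) pi) => [c|x] /=; first by rewrite PhiC PsiC.
  have [[i b] ->] : exists b : cvar J tl, x = enum_rank b.
    by exists (enum_val x); rewrite enum_valK.
  rewrite -[X in Phi X]/(coef_var b) -[X in pi X]/(coef_var b) Phi_coef.
  rewrite -mcoeff_map_mpoly /ufam map_prodfam (prodfam_ext _ PsiX).
  rewrite -hd ?(gen_index_lt fr JE) // -Fgen map_gen_poly mcoeffD mcoeffX.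
  have /(gen_tailP tlP JE)[bt _] := valP b.
  case: eqP => [e|_]; first by move: bt; rewrite e => /(tl_irr ltP tlP).
  rewrite add0r raddf_sum (bigD1 b) //= mcoeffZ mcoeffX eqxx mulr1 big1 ?addr0 //.
  by move=> c cb; rewrite mcoeffZ mcoeffX (inj_eq val_inj) (negPf cb) mulr0.
(* [g] carries the family [F] to the universal product family, and a product family determines its
   coordinates. *)
have gd : {in params tl [::] v, g \o d =1 universal}.
  apply: (prodfam_inj ltP tlP fr) => l lv; rewrite -map_prodfam -hd //.
  rewrite -[l in LHS]/(val (Ordinal lv)) FE.
  rewrite (map_mpoly_trans gpi) Phi_gen /ufam /gen_index hiota /genJ index_uniq ?size_gens //.
  exact: gens_uniq.
apply: (@mpoly_rmorph_eq _ _ _ (g \o Psi) idfun) => [c|x] /=.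
  by rewrite PsiC gpi PhiC.
rewrite /Psi /= mmapX mmap1U.
have xP : tnth (in_tuple coords) x \in params tl [::] v by rewrite -mem_undup mem_tnth.
rewrite -[LHS]/((g \o d) _) gd // /universal.
by rewrite (tnth_nth (tnth (in_tuple coords) x)) /= index_uniq ?undup_uniq // valK.
Qed.

End AffineStratum.

Theorem corollary5p5 (k : fieldType) (n : nat) (lt : rel 'X_{1..n.+1})
    (q : nat) (a : nat -> nat) :
  term_order lt ->
  (1 <= q)%N -> (q <= n)%N ->
  (\sum_(1 <= i < q.+1) a i)%N <> 0%N ->
  stratum_is_affine_space (idealJ k n q a) (htail lt) /\
  (reliable lt -> stratum_is_affine_space (idealJ k n q a) (tail lt)).
Proof.
move=> ltP _ qn /idealJ_sP[sq as1]; set s := idealJ_s q a in sq as1.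
have qE : q = (s + (q - s.+1)).+1 by rewrite -addSn subnKC.
have fr : fresh [::] (jseq n a s (q - s.+1)).
  by split=> //; apply: uniq_jseq; rewrite -addSn subnKC.
have JE := mem_idealJ k qE (erefl : idealJ_s q a = s) as1 qn.
split=> [|rel]; apply: (stratum_affine ltP _ fr JE).
  exact: htail_order.
exact: reliable_tail_order.
Qed.
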